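(* Let $V$ be an infinite-dimensional vector space over a field $\mathbb{F}$, and let $u\in\mathrm{SP}_f(V)$ have determinant $\pm 1$. Then, in the algebra $\mathrm{End}(V)$, $-u$ is the product of three unipotent elements of index $2$.
   Context: $\mathrm{End}(V)$ is the algebra of all endomorphisms of $V$. $\mathrm{SP}_f(V)$ is the group of all automorphisms of $V$ of the form $\mathrm{id}_V+w$ with $w$ a finite-rank endomorphism of $V$. For $u\in\mathrm{SP}_f(V)$, the determinant of $u$ is the determinant of the endomorphism $u_{|W}$ of $W$ induced by $u$, where $W$ is any finite-dimensional linear subspace of $V$ that includes $\mathrm{Im}(u-\mathrm{id}_V)$ (this does not depend on the choice of $W$). In a unital algebra, an element $x$ is unipotent of index $2$ if $(x-1)^2=0$. *)

(* Defs.v *)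
From HB Require Import structures.
From mathcomp Require Import all_boot all_order all_algebra.
From mathcomp Require Import boolp.

Set Implicit Arguments.
Unset Strict Implicit.
Unset Printing Implicit Defensive.

Import GRing.Theory.
Local Open Scope ring_scope.

(* End(V), as a ring under composition: (f * g) v = f (g v). It is only a
   pzRingType, because 1 = 0 in End(V) when V = 0. *)
Definition endo (F : fieldType) (V : lmodType F) := {linear V -> V}.

Definition endo_fun (F : fieldType) (V : lmodType F) (f : endo V) : V -> V := f.
Coercion endo_fun : endo >-> Funclass.

Section EndoRing.
Variables (F : fieldType) (V : lmodType F).
Implicit Types f g h : endo V.

Lemma endoP f g : f =1 g -> f = g.
Proof.
case: f g => [f [[fD] [fZ]]] [g [[gD] [gZ]]] /funext fg.
rewrite /endo_fun /= in fg; subst g.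
by rewrite (Prop_irrelevance fD gD) (Prop_irrelevance fZ gZ).
Qed.

HB.instance Definition _ (f : endo V) := GRing.Linear.copy (endo_fun f) (f : {linear V -> V}).

HB.instance Definition _ := gen_eqMixin (endo V).
HB.instance Definition _ := gen_choiceMixin (endo V).

Definition endo0 : endo V := \0 : {linear V -> V}.
Definition endo1 : endo V := idfun : {linear V -> V}.
Definition endo_opp f : endo V := (\- f) : {linear V -> V}.
Definition endo_add f g : endo V := (f \+ g) : {linear V -> V}.
Definition endo_mul f g : endo V := (f \o g) : {linear V -> V}.

Lemma endo_addA : associative endo_add.
Proof. by move=> f g h; apply: endoP => v; exact: addrA. Qed.
Lemma endo_addC : commutative endo_add.
Proof. by move=> f g; apply: endoP => v; exact: addrC. Qed.
Lemma endo_add0 : left_id endo0 endo_add.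
Proof. by move=> f; apply: endoP => v; exact: add0r. Qed.
Lemma endo_addN : left_inverse endo0 endo_opp endo_add.
Proof. by move=> f; apply: endoP => v; exact: addNr. Qed.

HB.instance Definition _ :=
  GRing.isZmodule.Build (endo V) endo_addA endo_addC endo_add0 endo_addN.

Lemma endo_mulA : associative endo_mul.
Proof. by move=> f g h; apply: endoP. Qed.
Lemma endo_mul1l : left_id endo1 endo_mul.
Proof. by move=> f; apply: endoP. Qed.
Lemma endo_mul1r : right_id endo1 endo_mul.
Proof. by move=> f; apply: endoP. Qed.
Lemma endo_mulDl : left_distributive endo_mul +%R.
Proof. by move=> f g h; apply: endoP. Qed.
Lemma endo_mulDr : right_distributive endo_mul +%R.
Proof. by move=> f g h; apply: endoP => v; exact: (raddfD (f : {linear V -> V})). Qed.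

HB.instance Definition _ := GRing.Zmodule_isPzRing.Build (endo V)
  endo_mulA endo_mul1l endo_mul1r endo_mulDl endo_mulDr.

Lemma endo0E v : (0 : endo V) v = 0. Proof. by []. Qed.
Lemma endo1E v : (1 : endo V) v = v. Proof. by []. Qed.
Lemma endoNE f v : (- f) v = - f v. Proof. by []. Qed.
Lemma endoDE f g v : (f + g) v = f v + g v. Proof. by []. Qed.
Lemma endoBE f g v : (f - g) v = f v - g v. Proof. by []. Qed.
Lemma endoME f g v : (f * g) v = f (g v). Proof. by []. Qed.

End EndoRing.

Definition unipotent2 (R : pzRingType) (x : R) : Prop := (x - 1) ^+ 2 = 0.

Section FiniteRank.
Variables (F : fieldType) (V : lmodType F).
Implicit Types u w : endo V.

Definition lcomb n (e : 'I_n -> V) (c : 'rV[F]_n) : V := \sum_i c 0 i *: e i.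

Definition spanned n (e : 'I_n -> V) (v : V) : Prop := exists c, v = lcomb e c.

Definition lin_indep n (e : 'I_n -> V) : Prop :=
  forall c, lcomb e c = 0 -> c = 0.

Definition infinite_dim : Prop :=
  ~ exists n (e : 'I_n -> V), forall v, spanned e v.

Definition finite_rank w : Prop :=
  exists n (e : 'I_n -> V), forall v, spanned e (w v).

Definition SPf u : Prop :=
  bijective u /\ exists2 w : endo V, finite_rank w & u = 1 + w.

(* d is the determinant of the endomorphism of W induced by u, for some
   finite-dimensional subspace W that includes Im (u - id); W is given by a
   basis e, and A is the matrix of u|_W in e (row i lists the coordinates of
   u (e i)).  By SPf_has_det and has_det_uniq below, for u in SP_f(V) there is
   exactly one such d, whatever W and e. *)
Definition has_det u (d : F) : Prop :=
  exists n (e : 'I_n -> V) (A : 'M[F]_n),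
    [/\ lin_indep e,
        forall v, spanned e ((u - 1) v),
        forall i, u (e i) = lcomb e (row i A)
      & d = \det A].

Lemma lcombD n (e : 'I_n -> V) a b : lcomb e (a + b) = lcomb e a + lcomb e b.
Proof. by rewrite -big_split; apply: eq_bigr => i _; rewrite mxE scalerDl. Qed.

Lemma lcombZ n (e : 'I_n -> V) k a : lcomb e (k *: a) = k *: lcomb e a.
Proof. by rewrite scaler_sumr; apply: eq_bigr => i _; rewrite mxE scalerA. Qed.

Lemma lcombB n (e : 'I_n -> V) a b : lcomb e (a - b) = lcomb e a - lcomb e b.
Proof. by rewrite -[- b]scaleN1r lcombD lcombZ scaleN1r. Qed.

Lemma lcomb_delta n (e : 'I_n -> V) i : lcomb e (delta_mx 0 i) = e i.
Proof.
rewrite /lcomb (bigD1 i) //= mxE !eqxx scale1r big1 ?addr0 // => j ji.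
by rewrite mxE (negPf ji) andbF scale0r.
Qed.

Lemma lin_indep_inj n (e : 'I_n -> V) : lin_indep e -> injective (lcomb e).
Proof.
by move=> he a b ab; apply/eqP; rewrite -subr_eq0; apply/eqP/he;
  rewrite lcombB ab subrr.
Qed.

Lemma lcomb_mul m n (f : 'I_m -> V) (e : 'I_n -> V) (M : 'M_(m, n)) a :
  (forall i, f i = lcomb e (row i M)) -> lcomb f a = lcomb e (a *m M).
Proof.
move=> fM; rewrite /lcomb; under eq_bigr do rewrite fM scaler_sumr.
rewrite exchange_big; apply: eq_bigr => j _ /=; rewrite mxE scaler_suml.
by apply: eq_bigr => i _; rewrite mxE scalerA.
Qed.

Lemma endo_lcomb n (e : 'I_n -> V) w a : w (lcomb e a) = lcomb (w \o e) a.
Proof.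
rewrite (raddf_sum (w : {linear V -> V})); apply: eq_bigr => i _.
exact: (linearZ_LR (w : {linear V -> V})).
Qed.

Lemma spanned_mx m n (f : 'I_m -> V) (e : 'I_n -> V) :
  (forall i, spanned e (f i)) ->
  exists M : 'M_(m, n), forall i, f i = lcomb e (row i M).
Proof.
move=> /choice[c fc]; exists (\matrix_i c i) => i.
by rewrite rowK.
Qed.

Lemma spanned_basis n (e : 'I_n -> V) : exists m (f : 'I_m -> V),
  lin_indep f /\ forall v, spanned e v -> spanned f v.
Proof.
elim: n e => [|n IH] e.
  by exists 0%N, e; split=> // c _; apply/rowP; case.
have [he|] := pselect (lin_indep e); first by exists n.+1, e.
rewrite /lin_indep -existsNE => -[c /not_implyP[c0 /eqP/rV0Pn[i ci]]].
have [m [f [hf fe]]] := IH (e \o lift i).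
exists m, f; split=> // v [a ->]; apply: fe.
exists (\row_j (a - (a 0 i / c 0 i) *: c) 0 (lift i j)).
have -> : lcomb e a = lcomb e (a - (a 0 i / c 0 i) *: c).
  by rewrite lcombB lcombZ c0 scaler0 subr0.
rewrite {1}/lcomb (bigD1_ord i) //= !mxE mulfVK // subrr scale0r add0r.
by apply: eq_bigr => j _; rewrite !mxE.
Qed.

Lemma SPf_has_det u : SPf u -> exists d, has_det u d.
Proof.
case=> _ [w [n [e we]] uE].
have [m [f [hf ef]]] := spanned_basis e.
have uf v : spanned f ((u - 1) v).
  by apply: ef; rewrite uE addrC addKr; exact: we.
have [B BE] := spanned_mx (fun i => uf (f i)).
exists (\det (1%:M + B)), m, f, (1%:M + B); split=> // i.
by rewrite linearD /= lcombD row1 lcomb_delta -BE endoBE endo1E addrC subrK.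
Qed.

Lemma det_1D_mulC m n (P : 'M[F]_(m, n)) (Q : 'M[F]_(n, m)) :
  \det (1%:M + P *m Q) = \det (1%:M + Q *m P).
Proof.
have E1 : block_mx 1%:M (- P) Q 1%:M
  = block_mx 1%:M 0 Q 1%:M *m block_mx 1%:M (- P) 0 (1%:M + Q *m P).
  by rewrite mulmx_block !mul1mx !mul0mx ?mulmx1 ?mulmx0 ?addr0 mulmxN
             addrCA addNr addr0.
have E2 : block_mx 1%:M (- P) Q 1%:M
  = block_mx (1%:M + P *m Q) (- P) 0 1%:M *m block_mx 1%:M 0 Q 1%:M.
  by rewrite mulmx_block !mul1mx !mul0mx ?mulmx1 ?mulmx0 ?add0r mulNmx addrK.
have := congr1 determinant (etrans (esym E1) E2).
by rewrite !det_mulmx !det_ublock !det_lblock !det1 !mul1r !mulr1 => ->.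
Qed.

Lemma has_det_uniq u d d' : has_det u d -> has_det u d' -> d = d'.
Proof.
case=> n [e [A [he ue Ae ->]]] [n' [e' [A' [he' ue' Ae' ->]]]] {d d'}.
have [B BE] := spanned_mx (fun i => ue (e i)).
have [C CE] := spanned_mx (fun i => ue (e' i)).
have [B' B'E] := spanned_mx (fun i => ue' (e' i)).
have [D DE] := spanned_mx (fun i => ue' (e i)).
have AB m (f : 'I_m -> V) (X Y : 'M_m) : lin_indep f ->
    (forall i, u (f i) = lcomb f (row i X)) ->
    (forall i, (u - 1) (f i) = lcomb f (row i Y)) -> X = 1%:M + Y.
  move=> hf fX fY; apply/row_matrixP => i; apply: (lin_indep_inj hf).
  by rewrite linearD /= lcombD row1 lcomb_delta -fY -fX endoBE addrC subrK.
rewrite (AB _ _ _ _ he Ae BE) (AB _ _ _ _ he' Ae' B'E).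
pose S := col_mx B C; pose M := row_base S; pose N := col_base S.
have SE : S = N *m M by rewrite mulmx_base.
pose f i := lcomb e (row i M).
pose P := usubmx N; pose Q := dsubmx N.
have BPM : B = P *m M by rewrite mul_usub_mx -SE col_mxKu.
have CQM : C = Q *m M by rewrite mul_dsub_mx -SE col_mxKd.
have fe i : f i = lcomb e (row i M) by [].
have hf : lin_indep f.
  move=> c; rewrite (lcomb_mul _ fe) => /he cM0.
  by apply: (row_free_inj (row_base_free S)); rewrite -/M cM0 mul0mx.
have Pf i : ((u - 1) \o e) i = lcomb f (row i P).
  by rewrite (lcomb_mul _ fe) -row_mul -BPM -BE.
have Qf i : ((u - 1) \o e') i = lcomb f (row i Q).
  by rewrite (lcomb_mul _ fe) -row_mul -CQM -CE.
have : (M <= S)%MS by rewrite eq_row_base.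
case/submxP => L ML.
pose M' := lsubmx L *m D + rsubmx L *m B'.
have fM' i : f i = lcomb e' (row i M').
  rewrite fe ML -[L in L *m S]hsubmxK mul_row_col !linearD /= !lcombD.
  rewrite !row_mul -(lcomb_mul _ BE) -(lcomb_mul _ CE).
  by rewrite (lcomb_mul _ DE) (lcomb_mul _ B'E).
have B'QM : B' = Q *m M'.
  apply/row_matrixP => i; apply: (lin_indep_inj he').
  by rewrite row_mul -B'E -(lcomb_mul _ fM') -Qf.
have MPQ : M *m P = M' *m Q.
  apply/row_matrixP => i; apply: (lin_indep_inj hf).
  rewrite (row_mul i M) (row_mul i M') -(lcomb_mul _ Pf) -(lcomb_mul _ Qf).
  by rewrite -!endo_lcomb -fe fM'.
by rewrite BPM B'QM det_1D_mulC MPQ det_1D_mulC.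
Qed.

End FiniteRank.

Arguments infinite_dim {F} V.

(* Main.v *)
Require Import Defs.
From HB Require Import structures.
From mathcomp Require Import all_boot all_order all_algebra.
From mathcomp Require Import boolp classical_sets functions cardinality.
From mathcomp Require Import ring zify.

Set Implicit Arguments.
Unset Strict Implicit.
Unset Printing Implicit Defensive.

Import GRing.Theory.
Local Open Scope ring_scope.

(** Write u = 1 + w with w of finite rank, and let A be the matrix of u on a
    basis kappa of Im w, so that det A = det u.  Since ker w is huge, the
    preimages f_i of the kappa_i can be chosen independent of Im w, and V has
    a basis made of the f_i, the kappa_i and an infinite part B of ker w, with
    u f_i = f_i + kappa_i ([adapted_basis]).  Finitely many vectors of ker w can
    be adjoined at will to the f_i and to the kappa_i; the rest of B falls into
    pairs, and on each of the planes spanned by these pairs -u is -1, which is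
    an explicit product of three unipotents ([neg_unip3_extend]).  There remains
    a question on matrices: to factor the opposite of g = [1, J; 0, diag(A, 1)],
    where J = diag(1, 0) and the borders 1 and 0 have free sizes.

    The opposite of a block matrix [a, v; c, h] is a product of three
    unipotents of index 2 as soon as its Schur complement h - c a^-1 v is the
    inverse of a matrix b similar to a, or such that a is similar to
    diag(-1, b) ([neg_unip3_block]).  Conjugating g by [1, 0; T, 1] turns the
    upper left block into a = [D A, U; 0, 1], with b = [D, 0; W, 1], where D, U
    and W are arbitrary ([neg_unip3_of_factor]).  Without borders and with
    det A = 1, one would thus need D A similar to D, that is, A should be a
    commutator.  The borders give enough room for a statement that is uniform
    in the field and in A: one can take a similar to diag(delta d, C) and b
    similar to diag(d, C), where delta = det A and d is any nonzero scalar
    ([stable_ratio], [stable_ratio_unit]).  For d = 1, the case delta = 1 gives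
    a similar to b, and the case delta = -1 gives, with one more border, a
    similar to diag(-1, b).

    Because d is free, the property passes from A1 and A2 to diag(A1, A2): the
    scalar delta1 d produced by A1 serves as the d of A2 and cancels
    ([stable_ratio_diag]).  As every matrix is similar to a direct sum of
    companion matrices, it is enough to treat a companion matrix
    ([stable_ratio_companion]).  There D is upper triangular, and both bordered
    matrices decompose as one scalar plus a single unipotent Jordan block. *)

Ltac entrywise_ring := apply/matrixP => ? ?; rewrite !mxE; ring.

(** * Similarity of matrices *)

Section Matrices.
Variable F : fieldType.

Let mx01 := (mul1mx, mulmx1, mul0mx, mulmx0, addr0, add0r, subr0, sub0r, oppr0).

(** The sizes p and q are kept apart, although similarity forces p = q: block
    decompositions such as (m + n) + p and m + (n + p) can then be compared
    without casts. *)
Definition similar p q (X : 'M[F]_p) (Y : 'M[F]_q) : Prop :=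
  exists (P : 'M_(p, q)) (P' : 'M_(q, p)),
    [/\ P *m P' = 1%:M, P' *m P = 1%:M & X = P *m Y *m P'].

Lemma similar_refl p (X : 'M[F]_p) : similar X X.
Proof. by exists 1%:M, 1%:M; rewrite !mx01. Qed.

Lemma similar_sym p q (X : 'M[F]_p) (Y : 'M[F]_q) : similar X Y -> similar Y X.
Proof.
case=> P [P' [PP' P'P ->]]; exists P', P; split=> //.
by rewrite !mulmxA P'P mul1mx -mulmxA P'P mulmx1.
Qed.

Lemma similar_trans p q r (X : 'M[F]_p) (Y : 'M[F]_q) (Z : 'M[F]_r) :
  similar X Y -> similar Y Z -> similar X Z.
Proof.
case=> P [P' [PP' P'P ->]] [Q [Q' [QQ' Q'Q ->]]]; exists (P *m Q), (Q' *m P').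
split; last by rewrite !mulmxA.
  by rewrite !mulmxA -(mulmxA P) QQ' mulmx1.
by rewrite !mulmxA -(mulmxA Q') P'P mulmx1.
Qed.

Lemma similar_tr p q (X : 'M[F]_p) (Y : 'M[F]_q) :
  similar X Y -> similar X^T Y^T.
Proof.
case=> P [P' [PP' P'P ->]]; exists P'^T, P^T.
by split; rewrite -?trmx_mul ?PP' ?P'P ?trmx1 // !trmx_mul mulmxA.
Qed.

Lemma similar_diag p1 p2 q1 q2 (X1 : 'M[F]_p1) (Y1 : 'M[F]_q1) (X2 : 'M[F]_p2)
    (Y2 : 'M[F]_q2) :
  similar X1 Y1 -> similar X2 Y2 ->
  similar (block_mx X1 0 0 X2) (block_mx Y1 0 0 Y2).
Proof.
case=> P [P' [PP' P'P ->]] [Q [Q' [QQ' Q'Q ->]]].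
exists (block_mx P 0 0 Q), (block_mx P' 0 0 Q').
by split; rewrite !mulmx_block !mx01 ?PP' ?P'P ?QQ' ?Q'Q -?scalar_mx_block.
Qed.

Lemma similar_block_swap p q (X : 'M[F]_p) (Y : 'M[F]_q) U W :
  similar (block_mx X U W Y) (block_mx Y W U X).
Proof.
exists (block_mx 0 1%:M 1%:M 0), (block_mx 0 1%:M 1%:M 0).
by split; rewrite !mulmx_block !mx01 -?scalar_mx_block.
Qed.

(** The last block of three moves to the second place. *)
Lemma similar_block3 p q r (X : 'M[F]_p) (Y : 'M[F]_q) (Z : 'M[F]_r)
    U W U1 U2 W1 W2 :
  similar (block_mx (block_mx X U W Y) (col_mx U1 U2) (row_mx W1 W2) Z)
          (block_mx X (row_mx U1 U) (col_mx W1 W) (block_mx Z W2 U2 Y)).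
Proof.
exists (block_mx (col_mx 1%:M 0) (col_mx 0 (row_mx 0 1%:M)) 0 (row_mx 1%:M 0)).
exists (block_mx (row_mx 1%:M 0) 0 (col_mx 0 (row_mx 0 1%:M)) (col_mx 1%:M 0)).
pose E := (mul_row_block, mul_row_col, mul_col_mx, mul_mx_row, mx01,
  add_col_mx, add_row_mx, row_mx0, col_mx0).
split; rewrite !mulmx_block ?scalar_mx_block; congr block_mx;
  rewrite ?block_mxEv ?E //.
rewrite -[X in row_mx (col_mx _ _) X]col_mx0 -block_mxEh block_mxEv.
by rewrite add_col_mx !add_row_mx !addr0 !add0r.
Qed.

Lemma similar_interleave p1 p2 q1 q2 (X1 : 'M[F]_p1) (X2 : 'M[F]_p2)
    (Y1 : 'M[F]_q1) (Y2 : 'M[F]_q2) U1 U2 W1 W2 :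
  similar (block_mx (block_mx X1 0 0 X2) (block_mx U1 0 0 U2)
                    (block_mx W1 0 0 W2) (block_mx Y1 0 0 Y2))
          (block_mx (block_mx X1 U1 W1 Y1) 0 0 (block_mx X2 U2 W2 Y2)).
Proof.
pose P m1 m2 n1 n2 : 'M[F]_((m1 + m2) + (n1 + n2), (m1 + n1) + (m2 + n2)) :=
  block_mx (block_mx 1%:M 0 0 0) (block_mx 0 0 1%:M 0)
           (block_mx 0 1%:M 0 0) (block_mx 0 0 0 1%:M).
exists (P _ _ _ _), (P _ _ _ _).
by split; rewrite /P !(mulmx_block, mx01, add_block_mx) ?block_mx0
  -?scalar_mx_block.
Qed.

Lemma similar_det p q (X : 'M[F]_p) (Y : 'M[F]_q) :
  similar X Y -> \det X = \det Y.
Proof.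
case=> P [P' [PP' P'P ->]].
have pq : p = q.
  by apply/eqP; rewrite eqn_leq (mulmx1_min PP') (mulmx1_min P'P).
subst q; rewrite !det_mulmx mulrAC -det_mulmx PP'.
by rewrite det1 mul1r.
Qed.

(** * Opposites of block matrices as products of three unipotents *)
Definition neg_unip3 n (G : 'M[F]_n) : Prop :=
  exists X Y Z : 'M[F]_n,
    [/\ unipotent2 X, unipotent2 Y, unipotent2 Z & - G = X *m Y *m Z].

Lemma unip2_conj p q (P : 'M[F]_(p, q)) P' (X : 'M[F]_q) :
  P *m P' = 1%:M -> P' *m P = 1%:M -> unipotent2 X ->
  unipotent2 (P *m X *m P').
Proof.
move=> PP' P'P; rewrite /unipotent2 !expr2 -!mulmxE => X2.
have -> : P *m X *m P' - 1%R = P *m (X - 1%R) *m P'.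
  by rewrite mulmxBr mulmxBl mulmx1 PP'.
by rewrite !mulmxA -(mulmxA _ P') P'P mulmx1 -(mulmxA P) X2 mulmx0 mul0mx.
Qed.

Lemma similar_neg_unip3 p q (G : 'M[F]_p) (H : 'M[F]_q) :
  similar G H -> neg_unip3 H -> neg_unip3 G.
Proof.
case=> P [P' [PP' P'P ->]] [X [Y [Z [X2 Y2 Z2 HE]]]].
exists (P *m X *m P'), (P *m Y *m P'), (P *m Z *m P').
split; try exact: unip2_conj.
by rewrite -mulNmx -mulmxN HE !mulmxA -!(mulmxA _ P' P) P'P !mulmx1.
Qed.

Lemma unip2_block p q (X : 'M[F]_p) U W (Y : 'M[F]_q) :
  (X - 1%:M) *m (X - 1%:M) + U *m W = 0 ->
  (X - 1%:M) *m U + U *m (Y - 1%:M) = 0 ->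
  W *m (X - 1%:M) + (Y - 1%:M) *m W = 0 ->
  W *m U + (Y - 1%:M) *m (Y - 1%:M) = 0 ->
  unipotent2 (block_mx X U W Y).
Proof.
move=> h1 h2 h3 h4; rewrite /unipotent2 expr2 -mulmxE.
have -> : block_mx X U W Y - 1%R = block_mx (X - 1%:M) U W (Y - 1%:M).
  rewrite -[1%R]/(1%:M) [X in _ - X]scalar_mx_block opp_block_mx.
  by rewrite add_block_mx !oppr0 !addr0.
by rewrite mulmx_block h1 h2 h3 h4 -[RHS]/(0 : 'M_(_,_)) -[RHS]block_mx0.
Qed.

(** The hypothesis on s and e says that a is similar to b when s is invertible,
    and in general that a is similar to the direct sum of b and of -1.
    The middle factor Y below is the block analogue of a 2 x 2 matrix with
    trace 2 and determinant 1, and it agrees up to sign with the given matrix on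
    its first block column, modulo a shear.  Multiplying by shears on both sides
    reaches every v and c, and the Schur complement is then forced. *)
Lemma neg_unip3_block p q (a a' : 'M[F]_p) (b b' : 'M[F]_q) s e v c h :
  a *m a' = 1%:M -> a' *m a = 1%:M -> b *m b' = 1%:M -> b' *m b = 1%:M ->
  e *m s = 1%:M -> 1%:M + a = s *m (1%:M + b) *m e ->
  h = c *m a' *m v + b' -> neg_unip3 (block_mx a v c h).
Proof.
move=> aa' a'a bb' b'b es asb ->.
pose g := 1%:M + b.
have sa : (1%:M + a) *m s = s *m g by rewrite asb -mulmxA es mulmx1.
have ea : e *m (1%:M + a) = g *m e by rewrite asb !mulmxA es mul1mx.
have as_ : a *m s = s *m b.
  by move: sa; rewrite mulmxDl mulmxDr mul1mx mulmx1 => /addrI.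
have ea_ : e *m a = b *m e.
  by move: ea; rewrite mulmxDl mulmxDr mul1mx mulmx1 => /addrI.
(* If p = q and s = e = 1 then these are the shear by c a' + (1 + a)^2 a',
   the matrix [-a, -1; (1 + a)^2, 2 + a] and the shear by a' v - a'. *)
exists (block_mx 1%:M 0 (c *m a' + g *m g *m b' *m e) 1%:M).
exists (block_mx (- a) (- s) (g *m g *m e) (1%:M + g)).
exists (block_mx 1%:M (a' *m v - s *m b') 0 1%:M).
have Na : - a - 1%:M = - (1%:M + a) by rewrite opprD addrC.
split.
- by apply: unip2_block; rewrite !subrr !mx01.
- apply: unip2_block; rewrite ?Na ?(addrC 1%:M g) ?addrK.
  + rewrite mulNmx mulmxN opprK mulNmx !mulmxA -sa -(mulmxA _ s) -mulmxA asb.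
    by rewrite -/g !mulmxA subrr.
  + by rewrite mulNmx mulmxN opprK sa mulNmx subrr.
  + by rewrite mulmxN -!mulmxA ea addNr.
  + by rewrite mulmxN -!mulmxA es mulmx1 addNr.
- by apply: unip2_block; rewrite !subrr !mx01.
have cE : - c = (c *m a' + g *m g *m b' *m e) *m - a + g *m g *m e.
  rewrite mulmxN mulmxDl -(mulmxA c) a'a mulmx1 -(mulmxA _ e) ea_ !mulmxA.
  by rewrite -(mulmxA _ b' b) b'b mulmx1 opprD addrNK.
rewrite !mulmx_block !mx01 opp_block_mx; congr block_mx.
- rewrite mulNmx mulmxBr !mulmxA aa' mul1mx as_ -(mulmxA s) bb' mulmx1.
  by rewrite opprB addrAC subrr sub0r.
- exact: cE.
rewrite -cE mulNmx mulmxBr mulmxN mulmxDl -(mulmxA _ e s) es mulmx1 !mulmxA.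
have -> : g *m g *m b' = b' + 1%:M + g.
  have -> : g *m g = 1%:M + b + g *m b.
    by rewrite {2}/g mulmxDr mulmx1.
  by rewrite mulmxDl -mulmxA bb' mulmx1 mulmxDl mul1mx bb'.
have -> : c *m a' *m s = c *m s *m b'.
  rewrite -[c *m a' *m s]mulmx1 -bb' !mulmxA -(mulmxA _ s b) -as_ !mulmxA.
  by rewrite -(mulmxA c) a'a mulmx1.
entrywise_ring.
Qed.

(** Conjugation by [1, 0; T, 1] brings the matrix to the form of
    [neg_unip3_block]: a becomes the upper left block, and the inverse of b is
    its Schur complement. *)
Lemma neg_unip3_ublock p q (J : 'M[F]_(p, q)) (d : 'M_q) (T : 'M_(q, p))
    a b s e :
  a \in unitmx -> b \in unitmx ->
  a = 1%:M + J *m T -> b *m d = 1%:M + T *m J ->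
  e *m s = 1%:M -> 1%:M + a = s *m (1%:M + b) *m e ->
  neg_unip3 (block_mx 1%:M J 0 d).
Proof.
move=> ua ub aE bE es asb.
have Lsim : similar (block_mx 1%:M J 0 d)
    (block_mx a J (d *m T - T *m a) (d - T *m J)).
  exists (block_mx 1%:M 0 T 1%:M), (block_mx 1%:M 0 (- T) 1%:M).
  split; rewrite !mulmx_block !mx01 ?addrN ?addNr -?scalar_mx_block //.
  have cancel n (x y : 'M[F]_(q, n)) : x + (y - x) = y by rewrite addrC subrK.
  by rewrite !cancel !mulmxN aE addrK subrr.
apply: (similar_neg_unip3 Lsim).
have b'E : invmx b = d *m (1%:M - T *m invmx a *m J).
  rewrite -[RHS](mulKmx ub) -[LHS]mulmx1; congr (_ *m _).
  rewrite mulmxA bE mulmxBr mulmx1 mulmxDl mul1mx.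
  have -> : T *m J *m (T *m invmx a *m J) = T *m (a - 1%:M) *m invmx a *m J.
    by rewrite aE [_ + J *m T]addrC addrK !mulmxA.
  rewrite mulmxBr mulmx1 !mulmxBl -(mulmxA T a) mulmxV // mulmx1.
  entrywise_ring.
apply: (neg_unip3_block (a' := invmx a) (b' := invmx b) (b := b)
  _ _ _ _ es asb); rewrite ?mulmxV ?mulVmx //.
rewrite b'E !mulmxBl -(mulmxA T a) mulmxV // mulmx1 mulmxBr mulmx1 !mulmxA.
entrywise_ring.
Qed.

(** Both sides determine delta, which is then det A; the point is that D A and
    D, once enlarged by borders U and W that add only the eigenvalue 1, differ
    by just one scalar summand.  The scalar d is arbitrary so that the summands
    of a direct sum can be chained. *)
Definition stable_ratio r (A : 'M[F]_r) (delta : F) : Prop :=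
  forall d : F, d != 0 ->
  exists m (D : 'M_r) (U : 'M_(r, m)) (W : 'M_(m, r)) q (C : 'M_q),
    [/\ C \in unitmx,
        similar (block_mx (D *m A) U 0 1%:M)
                (block_mx ((delta * d)%:M : 'M_1) 0 0 C)
      & similar (block_mx D 0 W 1%:M) (block_mx (d%:M : 'M_1) 0 0 C)].

Lemma similar_unit p q (X : 'M[F]_p) (Y : 'M[F]_q) :
  similar X Y -> (X \in unitmx) = (Y \in unitmx).
Proof. by move=> XY; rewrite !unitmxE (similar_det XY). Qed.

Lemma unit_diag p q (X : 'M[F]_p) (Y : 'M[F]_q) :
  (block_mx X 0 0 Y \in unitmx) = (X \in unitmx) && (Y \in unitmx).
Proof. by rewrite !unitmxE det_ublock unitrM. Qed.

Lemma unit_scal1 (c : F) : ((c%:M : 'M_1) \in unitmx) = (c != 0).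
Proof. by rewrite unitmxE det_scalar1 unitfE. Qed.

(** The matrix T = [D A - 1, U; W A, 0] makes [neg_unip3_ublock] apply. *)
Lemma neg_unip3_of_factor r m1 m2 (A D : 'M[F]_r) (U : 'M_(r, m1))
    (W : 'M_(m2, r)) s e :
  block_mx (D *m A) U 0 1%:M \in unitmx ->
  block_mx D 0 W 1%:M \in unitmx -> e *m s = 1%:M ->
  1%:M + block_mx (D *m A) U 0 1%:M
    = s *m (1%:M + block_mx D 0 W 1%:M) *m e ->
  neg_unip3 (block_mx 1%:M (block_mx 1%:M 0 0 0 : 'M_(r + m1, r + m2))
                      0 (block_mx A 0 0 1%:M)).
Proof.
move=> ua ub es asb.
apply: (@neg_unip3_ublock _ _ _ _
  (block_mx (D *m A - 1%:M) U (W *m A) 0) _ _ s e ua ub _ _ es asb).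
  rewrite mulmx_block !mx01 scalar_mx_block add_block_mx !mx01.
  by rewrite [1%:M + _]addrC subrK.
rewrite !mulmx_block !mx01 [in RHS]scalar_mx_block add_block_mx !mx01.
by rewrite [1%:M + _]addrC subrK.
Qed.

Lemma neg_unip3_of_stable_ratio r (A : 'M[F]_r) delta :
  stable_ratio A delta -> delta = 1 \/ delta = -1 ->
  exists m1 m2, neg_unip3
    (block_mx 1%:M (block_mx 1%:M 0 0 0 : 'M_(r + m1, r + m2))
              0 (block_mx A 0 0 1%:M)).
Proof.
move=> /(_ 1 (oner_neq0 _)) [m [D [U [W [q [C [uC simA simB]]]]]]] deltaE.
have ub : block_mx D 0 W 1%:M \in unitmx.
  by rewrite (similar_unit simB) unit_diag unit_scal1 oner_neq0.
case: deltaE => deltaE; rewrite deltaE mulr1 in simA.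
  exists m, m.
  have ua : block_mx (D *m A) U 0 1%:M \in unitmx.
    by rewrite (similar_unit simA) unit_diag unit_scal1 oner_neq0.
  have [P [P' [PP' P'P aE]]] := similar_trans simA (similar_sym simB).
  apply: (neg_unip3_of_factor ua ub P'P).
  by rewrite aE mulmxDr mulmxDl mulmx1 PP'.
(* One more border on the left turns diag(-1, C) into diag(-1, C, 1), hence
   into diag(-1, b) as b is similar to diag(1, C). *)
exists (1 + m)%N, m.
have simA1 : similar (block_mx (D *m A) (row_mx 0 U : 'M_(r, 1 + m)) 0 1%:M)
                     (block_mx ((-1)%:M : 'M_1) 0 0 (block_mx D 0 W 1%:M)).
  rewrite (scalar_mx_block 1 m) -[X in block_mx _ (row_mx _ _) X]col_mx0.
  apply: similar_trans (similar_sym (similar_block3 _ _ _ _ _ _ _ _ _)) _.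
  rewrite row_mx0 col_mx0.
  apply: similar_trans (similar_diag simA (similar_refl 1%:M)) _.
  rewrite -[X in block_mx _ X _ _]col_mx0 -[X in block_mx _ _ X _]row_mx0.
  apply: similar_trans (similar_block3 _ _ _ _ _ _ _ _ _) _.
  rewrite row_mx0 col_mx0.
  exact: similar_diag (similar_refl _) (similar_sym simB).
have ua1 : block_mx (D *m A) (row_mx 0 U : 'M_(r, 1 + m)) 0 1%:M \in unitmx.
  by rewrite (similar_unit simA1) unit_diag unit_scal1 oppr_eq0 oner_neq0.
have [P [P' [PP' P'P aE]]] := simA1.
apply: (@neg_unip3_of_factor _ _ _ _ _ _ _
  (P *m col_mx 0 1%:M) (row_mx 0 1%:M *m P') ua1 ub).
  by rewrite mulmxA -(mulmxA _ P') P'P mulmx1 mul_row_col !mx01.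
rewrite aE -PP' -[in X in X + _](mulmx1 P) -mulmxDl -mulmxDr.
rewrite !mulmxA; congr (_ *m _); rewrite -!mulmxA; congr (_ *m _).
rewrite scalar_mx_block add_block_mx !mx01 rmorphN addrN.
by rewrite mul_mx_row mul_col_row !mx01.
Qed.

(** * The ratio property for companion matrices *)
Lemma stable_ratio_similar p q (A : 'M[F]_p) (B : 'M[F]_q) delta :
  similar A B -> stable_ratio B delta -> stable_ratio A delta.
Proof.
move=> [P [P' [PP' P'P ->]]] sB d /sB[m [D [U [W [n [C [uC simA simB]]]]]]].
exists m, (P *m D *m P'), (P *m U), (W *m P'), n, C; split=> //.
  apply: similar_trans simA.
  exists (block_mx P 0 0 1%:M), (block_mx P' 0 0 1%:M).
  split; rewrite !mulmx_block !mx01 ?PP' ?P'P -?scalar_mx_block //.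
  by rewrite !mulmxA -(mulmxA _ P') P'P mulmx1.
apply: similar_trans simB; exists (block_mx P 0 0 1%:M), (block_mx P' 0 0 1%:M).
by split; rewrite !mulmx_block !mx01 ?PP' ?P'P -?scalar_mx_block.
Qed.

(** Apply the property of A to d and that of B to dA d.  The two sums are
    diag(dA d, C1, dB dA d, C2) and diag(d, C1, dA d, C2): they share the
    summand dA d, which joins C1 and C2 in the common part. *)
Lemma stable_ratio_diag p q (A : 'M[F]_p) (B : 'M[F]_q) dA dB :
  dA != 0 -> stable_ratio A dA -> stable_ratio B dB ->
  stable_ratio (block_mx A 0 0 B) (dB * dA).
Proof.
move=> dA0 sA sB d d0.
have [m1 [D1 [U1 [W1 [n1 [C1 [uC1 a1 b1]]]]]]] := sA d d0.
have dAd0 : dA * d != 0 by rewrite mulf_neq0.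
have [m2 [D2 [U2 [W2 [n2 [C2 [uC2 a2 b2]]]]]]] := sB _ dAd0.
exists (m1 + m2)%N, (block_mx D1 0 0 D2), (block_mx U1 0 0 U2).
exists (block_mx W1 0 0 W2), ((n1 + n2) + 1)%N.
exists (block_mx (block_mx C1 0 0 C2) 0 0 ((dA * d)%:M : 'M_1)).
pose C := block_mx C1 0 0 C2.
have reorder (x y : F) : similar
    (block_mx (block_mx (x%:M : 'M_1) 0 0 (y%:M : 'M_1)) 0 0 C)
    (block_mx (x%:M : 'M_1) 0 0 (block_mx C 0 0 (y%:M : 'M_1))).
  have := similar_block3 (x%:M : 'M_1) (y%:M : 'M_1) C 0 0 0 0 0 0.
  by rewrite !row_mx0 !col_mx0.
split.
- by rewrite !unit_diag unit_scal1 dAd0 uC1 uC2.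
- rewrite mulmx_block !mx01 [X in block_mx _ _ _ X]scalar_mx_block.
  rewrite -[X in block_mx _ _ X _]block_mx0.
  apply: similar_trans (similar_interleave _ _ _ _ _ _ _ _) _.
  apply: similar_trans (similar_diag a1 a2) _.
  apply: similar_trans (similar_sym (similar_interleave _ _ _ _ _ _ _ _)) _.
  rewrite !block_mx0.
  apply: similar_trans
    (similar_diag (similar_block_swap _ _ _ _) (similar_refl _)) _.
  by rewrite -mulrA; exact: reorder.
rewrite [X in block_mx _ _ _ X]scalar_mx_block.
rewrite -[X in block_mx _ X _ _]block_mx0.
apply: similar_trans (similar_interleave _ _ _ _ _ _ _ _) _.
apply: similar_trans (similar_diag b1 b2) _.
apply: similar_trans (similar_sym (similar_interleave _ _ _ _ _ _ _ _)) _.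
by rewrite !block_mx0; exact: reorder.
Qed.

Definition shift n : 'M[F]_n := \matrix_(i, j) (i == j.+1 :> nat)%:R.
Definition head_col n : 'cV[F]_n := \col_i (i == 0 :> nat)%:R.

Lemma shiftS n : shift n.+1 = block_mx (0 : 'M_1) 0 (head_col n) (shift n).
Proof.
apply/matrixP => i j; rewrite !mxE.
by case: (splitP (i : 'I_(1 + n))) => i' -> /=; rewrite !mxE;
  case: (splitP (j : 'I_(1 + n))) => j' -> /=; rewrite !mxE ?ord1.
Qed.

(** This is the identity behind [stable_ratio_companion]: the shift is inverted
    by its transpose, except on the first coordinate. *)
Lemma shift_mul_tr n :
  shift n *m (shift n)^T + head_col n *m (head_col n)^T = 1%:M.
Proof.
elim: n => [|n IHn]; first by apply/matrixP => -[].
rewrite shiftS (@tr_block_mx _ 1 n 1 n) !trmx0.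
have -> : head_col n.+1 = col_mx (1%:M : 'M_1) 0.
  apply/matrixP => i j; rewrite !mxE.
  by case: splitP => k; rewrite !mxE ?(ord1 j) ?(ord1 k) => ->.
rewrite (@tr_col_mx _ 1 n 1) trmx1 trmx0 (@mulmx_block _ 1 n 1 n 1 n).
rewrite (@mul_col_row _ 1 n 1 1 n) !mx01 (addrC (head_col n *m _)) IHn.
by rewrite (@add_block_mx _ 1 n 1 n) !mx01 -(@scalar_mx_block _ 1 n).
Qed.

Lemma det_scalarDshift c n : \det (c%:M + shift n) = c ^+ n.
Proof.
elim: n => [|n IHn]; first by rewrite det_mx00.
rewrite shiftS (@scalar_mx_block _ 1 n) (@add_block_mx _ 1 n 1 n) !mx01.
by rewrite (@det_lblock _ 1 n) IHn det_scalar1 exprS.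
Qed.

Lemma similar_shift_tr n : similar (1%:M + shift n) (1%:M + (shift n)^T).
Proof.
pose R : 'M[F]_n := \matrix_(i, j) (j == rev_ord i)%:R.
have RE m (X : 'M[F]_(n, m)) : R *m X = \matrix_(i, j) X (rev_ord i) j.
  apply/matrixP => i j; rewrite !mxE (bigD1 (rev_ord i)) //= big1 ?addr0.
    by rewrite mxE eqxx mul1r.
  by move=> k /negPf ki; rewrite mxE ki mul0r.
have RT : R^T = R.
  by apply/matrixP => i j; rewrite !mxE eq_sym (inv_eq rev_ordK).
have RR : R *m R = 1%:M.
  by rewrite RE; apply/matrixP => i j; rewrite !mxE rev_ordK eq_sym.
exists R, R; split=> //.
rewrite mulmxDr mulmxDl mulmx1 RR; congr (_ + _).
have -> : R *m (shift n)^T *m R = (R *m (R *m (shift n)^T)^T)^T.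
  by rewrite trmx_mul trmxK RT.
rewrite !RE; apply/matrixP => i j; rewrite !mxE /=; congr (_%:R).
have := ltn_ord i; have := ltn_ord j; lia.
Qed.

(** If d is not 1, the two diagonal blocks have no common eigenvalue, so the
    extension splits.  If d = 1, it splits because z lies in the image of the
    nilpotent part: this is what the borders are used for. *)
Lemma similar_split_shift (d : F) n (z : 'cV[F]_n) :
  z = shift n *m (shift n)^T *m z ->
  similar (block_mx (d%:M : 'M_1) 0 z (1%:M + shift n))
          (block_mx (d%:M : 'M_1) 0 0 (1%:M + shift n)).
Proof.
move=> zE.
have [y yE] : exists y, z = y *m d%:M - (1%:M + shift n) *m y.
  have [->|d1] := eqVneq d 1.
    exists (- ((shift n)^T *m z)).
    by rewrite mulmx1 mulmxDl mul1mx opprD addNKr mulmxN opprK mulmxA.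
  have u : (1 - d)%:M + shift n \in unitmx.
    by rewrite unitmxE det_scalarDshift unitfE expf_neq0 // subr_eq0 eq_sym.
  exists (- (invmx ((1 - d)%:M + shift n) *m z)).
  rewrite -{1}[z](mulKVmx u); set y := _ *m z.
  rewrite mulmxN opprK mulNmx mul_mx_scalar !mulmxDl mul1mx mul_scalar_mx.
  rewrite scalerBl scale1r; entrywise_ring.
exists (block_mx 1%:M 0 y 1%:M), (block_mx 1%:M 0 (- y) 1%:M).
split; rewrite !mulmx_block !mx01 ?addNr ?addrN -?scalar_mx_block //.
by rewrite yE mulmxN.
Qed.

Lemma similar_border p q (X : 'M[F]_p) (Y : 'M[F]_q) P P' m (U : 'M_(q, m)) :
  P *m P' = 1%:M -> P' *m P = 1%:M -> X = P *m Y *m P' ->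
  similar (block_mx X (P *m U) 0 1%:M) (block_mx Y U 0 (1%:M : 'M_m)).
Proof.
move=> PP' P'P ->; exists (block_mx P 0 0 1%:M), (block_mx P' 0 0 1%:M).
by split; rewrite !mulmx_block !mx01 ?PP' ?P'P -?scalar_mx_block.
Qed.

(** With S = 1 + N^T (an upper triangular Jordan block), D is sought in the form
    [d, x; 0, S], so that D is an extension of S by d for any x.  The relation
    N N^T + E E^T = 1 shows that (N + E p) S = 1 + N where p S = E^T: hence
    D A induces, modulo the row vector y0 = [1, -p], a conjugate of the
    Jordan block 1 + N.  The first row of D is chosen to make y0 an eigenvector
    of D A for the eigenvalue delta d, and comparing determinants shows that the
    corner entry of D is d.  A border of size one extends the Jordan block of
    each side by one, and [similar_split_shift] removes the coupling with the
    scalar. *)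
Lemma stable_ratio_companion k (c0 : 'M[F]_1) (c : 'rV_k) :
  let A := block_mx c0 c (head_col k) (shift k) in
  A \in unitmx -> stable_ratio A (\det A).
Proof.
move=> A uA d d0; set delta := \det A.
have delta0 : delta != 0 by rewrite -unitfE -unitmxE.
pose N := shift k; pose E := head_col k; pose S := 1%:M + N^T.
have detN : \det (1%:M + N) = 1 by rewrite det_scalarDshift expr1n.
have detS : \det S = 1 by rewrite -detN -[RHS]det_tr linearD /= trmx1.
have uS : S \in unitmx by rewrite unitmxE detS unitr1.
pose p := E^T *m invmx S.
have pS : p *m S = E^T by rewrite mulmxKV.
have XE : (N + E *m p) *m S = 1%:M + N.
  rewrite mulmxDl -mulmxA pS mulmxDr mulmx1 -addrA addrC; congr (_ + _).
  exact: shift_mul_tr.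
pose y := (delta * d) *: (row_mx 1%:M (- p) *m invmx A).
pose D : 'M_(1 + k) := block_mx (lsubmx y) (rsubmx y + E^T) 0 S.
have DAE : block_mx 1%:M (- p) 0 1%:M *m (D *m A)
  = block_mx (delta * d)%:M 0 (S *m E) (S *m (N + E *m p))
    *m block_mx 1%:M (- p) 0 1%:M.
  rewrite mulmxA mulmx_block !mx01 mulNmx pS addrK.
  have -> : block_mx (lsubmx y) (rsubmx y) 0 S = col_mx y (row_mx 0 S).
    by rewrite block_mxEv hsubmxK.
  rewrite mul_col_mx /y -scalemxAl mulmxKV // mul_row_block !mx01.
  rewrite mulmx_block !mx01 scale_row_mx scalemx1 -mul_scalar_mx block_mxEv.
  congr col_mx.
  by rewrite mulmxDr mulmxN mulmxA addrCA addNr addr0.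
have lE : lsubmx y = d%:M.
  have := congr1 determinant DAE.
  rewrite !det_mulmx !det_ublock det_lblock !det1 !mul1r mulr1 det_scalar1.
  have -> : \det (S *m (N + E *m p)) = 1.
    by rewrite det_mulmx mulrC -det_mulmx XE.
  rewrite mulr1 detS mulr1 mulrC => /(mulfI delta0) => ld.
  rewrite [lsubmx y]mx11_scalar -ld; congr (_%:M).
  by rewrite [X in \det X]mx11_scalar det_scalar1.
pose Q := block_mx (1%:M : 'M_1) 0 0 S.
pose Q' := block_mx (1%:M : 'M_1) 0 0 (invmx S).
pose L : 'M[F]_(1 + k) := block_mx 1%:M p 0 1%:M.
pose L' : 'M[F]_(1 + k) := block_mx 1%:M (- p) 0 1%:M.
pose R := L *m Q; pose R' := Q' *m L'.
have QQ' : Q *m Q' = 1%:M.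
  by rewrite mulmx_block !mx01 mulmxV // -scalar_mx_block.
have Q'Q : Q' *m Q = 1%:M.
  by rewrite mulmx_block !mx01 mulVmx // -scalar_mx_block.
have LL : L *m L' = 1%:M.
  by rewrite mulmx_block !mx01 addNr -scalar_mx_block.
have LL' : L' *m L = 1%:M.
  by rewrite mulmx_block !mx01 addrN -scalar_mx_block.
have RR' : R *m R' = 1%:M by rewrite mulmxA -(mulmxA _ Q) QQ' mulmx1.
have R'R : R' *m R = 1%:M.
  by rewrite mulmxA -(mulmxA Q') LL' mulmx1.
have DAR : D *m A = R *m block_mx (delta * d)%:M 0 E (1%:M + N) *m R'.
  rewrite -[LHS]mul1mx -LL -(mulmxA _ _ (D *m A)) DAE /R /R' !mulmxA.
  congr (_ *m _); rewrite -!mulmxA; congr (_ *m _); rewrite !mulmx_block !mx01.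
  by rewrite -XE !mulmxA mulmxK.
exists 1%N, D, (R *m col_mx 0 E), (row_mx 0 E^T), k.+1, (1%:M + shift k.+1).
have SE : 1%:M + shift k.+1 = block_mx (1%:M : 'M_1) 0 E (1%:M + N).
  by rewrite shiftS (@scalar_mx_block _ 1 k) (@add_block_mx _ 1 k 1 k) !mx01.
have splitE (e : F) (z : 'cV_k) :
    similar (block_mx (e%:M : 'M_1) 0 (col_mx 0 z : 'cV_(1 + k))
                      (1%:M + shift k.+1))
            (block_mx (e%:M : 'M_1) 0 0 (1%:M + shift k.+1)).
  apply: similar_split_shift.
  rewrite shiftS (@tr_block_mx _ 1 k 1 k) (@mulmx_block _ 1 k 1 k 1 k).
  by rewrite !trmx0 !mx01 addrC shift_mul_tr (@mul_block_col _ 1 k 1 k 1) !mx01.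
split.
- by rewrite unitmxE det_scalarDshift expr1n unitr1.
- apply: similar_trans (similar_border _ RR' R'R DAR) _.
  rewrite -[X in block_mx _ _ X]row_mx0.
  apply: similar_trans (similar_block3 _ _ _ _ _ _ _ _ _) _.
  by rewrite row_mx0 -SE; exact: splitE.
rewrite -[X in block_mx _ X _ _]col_mx0 /D lE.
apply: similar_trans (similar_block3 _ _ _ _ _ _ _ _ _) _.
rewrite col_mx0.
have -> : block_mx (1%:M : 'M_1) E^T 0 S = (1%:M + shift k.+1)^T.
  by rewrite SE (@tr_block_mx _ 1 k 1 k) trmx1 trmx0 linearD /= trmx1.
have trC : similar (1%:M + shift k.+1)^T (1%:M + shift k.+1).
  by rewrite linearD /= trmx1; exact: similar_sym (similar_shift_tr _).
apply: similar_trans _ (similar_diag (similar_refl _) trC).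
have := similar_tr (splitE d (rsubmx y + E^T)^T).
by rewrite !tr_block_mx !trmx0 tr_scalar_mx (@tr_col_mx _ 1 k 1) trmx0 trmxK.
Qed.

(** * Direct sums of companion matrices *)

(** The powers decrease, so that the matrix of A on these rows has the shape
    [c0, c; head_col, shift]. *)
Definition krylov r (A : 'M[F]_r) m (phi : 'rV_r) : 'M_(m, r) :=
  \matrix_(i < m) (phi *m A ^+ (m - i.+1)).

Lemma krylovS r (A : 'M[F]_r) m phi :
  krylov A m.+1 phi = col_mx (phi *m A ^+ m) (krylov A m phi).
Proof.
apply/matrixP => i j; rewrite !mxE.
case: (splitP (i : 'I_(1 + m))) => i' -> /=.
  by rewrite ord1 subSS subn0 mxE.
by rewrite !mxE add1n subSS.
Qed.

(** Take psi orthogonal to all the rows but the first: the matrix of the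
    scalars phi A^(i + j) psi is then triangular for the antidiagonal, with
    entries 1 on it. *)
Lemma krylov_dual r (A : 'M[F]_r) k (phi : 'rV_r) :
  row_free (krylov A k.+1 phi) ->
  exists psi : 'rV_r,
    krylov A k.+1 phi *m (krylov A^T k.+1 psi)^T \in unitmx.
Proof.
move=> Kfree; set K := krylov _ _ _.
pose w : 'cV_r := pinvmx K *m delta_mx 0 0.
have Kw : K *m w = delta_mx 0 0 by rewrite mulmxA mulmxVp // mul1mx.
exists w^T; pose h t := (phi *m A ^+ t *m w) 0 0.
have trX n : (A^T ^+ n)^T = A ^+ n.
  elim: n => [|n IHn]; first by rewrite !expr0 trmx1.
  by rewrite exprSr exprS -!mulmxE trmx_mul trmxK IHn.
have hE t : (t <= k)%N -> h t = (t == k)%:R.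
  move=> tk; have tk' : (k - t < k.+1)%N by rewrite ltnS leq_subr.
  have := congr1 (fun M => row (Ordinal tk') M 0 0) Kw.
  rewrite row_mul rowK /= subSS subKn // -/(h t) => ->; rewrite !mxE.
  by rewrite andbT -[_ == 0]/(k - t == 0)%N subn_eq0 eqn_leq tk.
have HE i j : (K *m (krylov A^T k.+1 w^T)^T) i j = h ((k - i) + (k - j))%N.
  transitivity ((row i K *m col j (krylov A^T k.+1 w^T)^T) 0 0).
    rewrite [LHS]mxE [RHS]mxE; apply: eq_bigr => l _.
    by rewrite [row _ _ _ _]mxE [col _ _ _ _]mxE.
  rewrite rowK -tr_row rowK trmx_mul trX trmxK !mulmxA.
  by rewrite /h exprD -mulmxE !mulmxA !subSS.
(* Reversing the rows makes the matrix triangular for the diagonal. *)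
pose R : 'M[F]_k.+1 := \matrix_(i, j) (j == rev_ord i)%:R.
suff : R *m (K *m (krylov A^T k.+1 w^T)^T) \in unitmx.
  by rewrite unitmx_mul => /andP[].
have RE i j : (R *m (K *m (krylov A^T k.+1 w^T)^T)) i j = h (i + (k - j))%N.
  rewrite !mxE (bigD1 (rev_ord i)) //= big1 ?addr0.
    rewrite mxE eqxx mul1r HE /= subSS subKn //; exact: leq_ord.
  by move=> l /negPf li; rewrite mxE li mul0r.
rewrite unitmxE det_trig; last first.
  apply/is_trig_mxP => i j ij; rewrite RE hE; last by have := ltn_ord j; lia.
  by case: eqP => //; have := ltn_ord j; lia.
rewrite big1 ?unitr1 // => i _; rewrite RE hE; last by have := ltn_ord i; lia.
by case: eqP => //; have := ltn_ord i; lia.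
Qed.

Lemma krylov_companion r (A : 'M[F]_r) k (phi : 'rV_r) :
  row_free (krylov A k.+1 phi) -> ~~ row_free (krylov A k.+2 phi) ->
  exists c0 (c : 'rV_k),
    krylov A k.+1 phi *m A
      = block_mx c0 c (head_col k) (shift k) *m krylov A k.+1 phi.
Proof.
rewrite (krylovS _ k.+1); set K := krylov A k.+1 phi; set u := phi *m _.
move=> Kfree; rewrite -kermx_eq0 => /rowV0Pn[v /sub_kermxP vK v0].
have {vK} vK : lsubmx (v : 'rV_(1 + k.+1)) *m u
               + rsubmx (v : 'rV_(1 + k.+1)) *m K = 0.
  by rewrite -mul_row_col hsubmxK.
pose a := (lsubmx (v : 'rV_(1 + k.+1))) 0 0.
have lE : lsubmx (v : 'rV_(1 + k.+1)) = a%:M by exact: mx11_scalar.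
rewrite lE mul_scalar_mx in vK.
have a0 : a != 0.
  apply: contra_neq v0 => a0; move: vK; rewrite a0 scale0r add0r => vK.
  have r0 : rsubmx (v : 'rV_(1 + k.+1)) = 0.
    by apply: (row_free_inj Kfree); rewrite vK mul0mx.
  by rewrite -[v](@hsubmxK _ 1 1 k.+1) lE r0 a0 raddf0 row_mx0.
pose c := - (a^-1 *: rsubmx (v : 'rV_(1 + k.+1))).
have uE : u = c *m K.
  rewrite /c mulNmx -scalemxAl -[rsubmx _ *m K](addKr (a *: u)) vK addr0.
  by rewrite scalerN opprK scalerA mulVf // scale1r.
exists (lsubmx (c : 'rV_(1 + k))), (rsubmx (c : 'rV_(1 + k))).
rewrite block_mxEv hsubmxK mul_col_mx -uE.
apply/row_matrixP => i; rewrite row_mul rowK -mulmxA mulmxE -exprSr.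
case: (splitP (i : 'I_(1 + k))) => [i'|i'] iE.
  have -> : i = lshift k i' by apply: val_inj.
  by rewrite (@rowKu _ 1 k) ord1 row_id /= subn1.
have -> : i = rshift 1 i' by apply: val_inj.
rewrite (@rowKd _ 1 k) row_mul.
have -> : row i' (row_mx (head_col k) (shift k))
          = delta_mx 0 (widen_ord (leqnSn k) i').
  apply/matrixP => a' j; rewrite (ord1 a') !mxE eqxx /=.
  case: (splitP (j : 'I_(1 + k))) => j' jE; rewrite mxE -val_eqE /= jE ?ord1;
    by rewrite eq_sym.
rewrite -[X in _ = X](rowE (widen_ord (leqnSn k) i') K) rowK /= add1n subSS.
by congr (_ *m _ ^+ _); rewrite subSS subnSK.
Qed.

(** Take the largest length k + 1 of a free Krylov family, among row vectors and
    column vectors together.  A family that attains it has a dual family of the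
    same length by [krylov_dual], and by maximality both span invariant
    subspaces.  Such a pair in duality splits off a cyclic summand. *)
Lemma krylov_pair r (A : 'M[F]_r) : (0 < r)%N ->
  exists k (phi psi : 'rV_r),
    [/\ krylov A k.+1 phi *m (krylov A^T k.+1 psi)^T \in unitmx,
        row_free (krylov A k.+1 phi) && ~~ row_free (krylov A k.+2 phi)
      & row_free (krylov A^T k.+1 psi) && ~~ row_free (krylov A^T k.+2 psi)].
Proof.
move=> r0.
pose good m := `[< exists phi : 'rV_r,
  row_free (krylov A m phi) || row_free (krylov A^T m phi) >].
have good1 : good 1%N.
  apply/asboolP; exists (const_mx 1).
  have -> : krylov A 1 (const_mx 1) = const_mx 1.
    by apply/row_matrixP => i; rewrite rowK ord1 subnn expr0 mulmx1 row_id.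
  rewrite /row_free rank_rV.
  apply/orP; left; apply/eqP; case: eqP => // /matrixP /(_ 0 (Ordinal r0)).
  by rewrite !mxE => /eqP; rewrite oner_eq0.
have good_le m : good m -> (m <= r)%N.
  by case/asboolP => phi /orP[] /eqP <-; exact: rank_leq_col.
case: (ex_maxnP (ex_intro good 1%N good1) good_le) => -[|k].
  by move=> _ /(_ _ good1).
move=> /asboolP[phi phik] max.
have bad B (psi : 'rV_r) : B \in [:: A; A^T] -> ~~ row_free (krylov B k.+2 psi).
  rewrite !inE => BA; apply/negP => Kfree.
  have := max k.+2; rewrite ltnn => max'.
  apply: (Bool.diff_false_true); apply: max'; apply/asboolP; exists psi.
  by case/orP: BA Kfree => /eqP -> ->; rewrite ?orbT.
have freeT B C (f : 'rV_r) g :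
    krylov B k.+1 f *m (krylov C k.+1 g)^T \in unitmx ->
    row_free (krylov C k.+1 g).
  move=> H; rewrite -row_leq_rank -[X in (X <= _)%N](mxrank_unit H).
  by rewrite -[\rank (krylov C _ _)]mxrank_tr mxrankM_maxr.
case/orP: phik => phik; have [psi H] := krylov_dual phik.
  exists k, phi, psi.
  by rewrite H phik (freeT _ _ _ _ H) !bad // !inE eqxx ?orbT.
have H' : krylov A k.+1 psi *m (krylov A^T k.+1 phi)^T \in unitmx.
  by rewrite -unitmx_tr trmx_mul trmxK; rewrite trmxK in H.
exists k, psi, phi; rewrite H' phik !bad ?inE ?eqxx ?orbT //.
rewrite trmxK in H; by rewrite (freeT _ _ _ _ H).
Qed.

(** The matrix W (K W)^-1 K is idempotent and commutes with A; the complement C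
    is the action of A on the image of the complementary idempotent. *)
Lemma similar_invariant_pair r m (A : 'M[F]_r) (K : 'M_(m, r))
    (W : 'M_(r, m)) B B' :
  K *m W \in unitmx -> K *m A = B *m K -> A *m W = W *m B' ->
  exists s (C : 'M_s), similar A (block_mx B 0 0 C).
Proof.
move=> uH KA AW; have [H HE] : exists H, K *m W = H by exists (K *m W).
rewrite HE in uH.
have HB : H *m B' = B *m H by rewrite -HE -mulmxA -AW !mulmxA KA.
pose p := W *m invmx H *m K; pose E := 1%:M - p.
have pA : p *m A = A *m p.
  rewrite /p !mulmxA AW -(mulmxA _ K) KA !mulmxA; congr (_ *m _).
  by rewrite -[LHS](mulmxK uH) -(mulmxA _ B) -HB !mulmxA mulmxKV.
have EA : E *m A = A *m E by rewrite mulmxBl mulmxBr pA mul1mx mulmx1.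
have KE : K *m E = 0.
  by rewrite mulmxBr mulmx1 /p !mulmxA HE mulmxV // mul1mx subrr.
have EW : E *m W = 0.
  by rewrite mulmxBl mul1mx /p -!mulmxA HE mulVmx // mulmx1 subrr.
have EE : E *m E = E.
  by rewrite {1}/E mulmxBl mul1mx /p -!mulmxA KE !mulmx0 subr0.
have [s [N [M [NM cancelN cancelM]]]] :
    exists s (N : 'M_(r, s)) (M : 'M_(s, r)),
    [/\ N *m M = E, forall n (X Y : 'M_(s, n)), N *m X = N *m Y -> X = Y
      & forall n (X Y : 'M_(n, s)), X *m M = Y *m M -> X = Y].
  exists (\rank E), (col_base E), (row_base E); split; first exact: mulmx_base.
    by move=> n X Y; exact: row_full_inj (col_base_full E) _ _.
  by move=> n X Y; exact: row_free_inj (row_base_free E) _ _.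
have MN : M *m N = 1%:M.
  by apply/cancelM/cancelN; rewrite mul1mx !mulmxA NM -mulmxA NM EE.
have KN : K *m N = 0 by apply: cancelM; rewrite -mulmxA NM KE mul0mx.
have MW : M *m W = 0 by apply: cancelN; rewrite mulmxA NM EW mulmx0.
exists s, (M *m A *m N).
exists (row_mx (W *m invmx H) N), (col_mx K M); split.
- by rewrite mul_row_col NM addrC subrK.
- rewrite mul_col_row !mulmxA HE mulmxV // KN MW mul0mx MN.
  by rewrite -scalar_mx_block.
have NCM : N *m (M *m A *m N) *m M = E *m A.
  by rewrite !mulmxA NM -(mulmxA _ N) NM -mulmxA -EA mulmxA EE.
rewrite mul_row_block !mx01 mul_row_col NCM -(mulmxA _ B) -KA mulmxA.
by rewrite -mulmxDl addrC subrK mul1mx.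
Qed.

Lemma stable_ratio_unit r (A : 'M[F]_r) :
  (0 < r)%N -> A \in unitmx -> stable_ratio A (\det A).
Proof.
elim/ltn_ind: r A => r IH A r0 uA.
have [k [phi [psi [uH /andP[Kf Kb] /andP[Lf Lb]]]]] := krylov_pair A r0.
have [c0 [c KA]] := krylov_companion Kf Kb.
have [e0 [e LA]] := krylov_companion Lf Lb.
have AW := congr1 trmx LA; rewrite !trmx_mul trmxK in AW.
have [s [C AC]] := similar_invariant_pair uH KA AW.
have := uA; rewrite (similar_unit AC) unit_diag => /andP[uB uC].
apply: (stable_ratio_similar AC); rewrite (similar_det AC) det_ublock mulrC.
have sB := stable_ratio_companion uB.
case: (posnP s) => [s0|s0]; last first.
  apply: stable_ratio_diag => //; first by rewrite -unitfE -unitmxE.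
  apply: IH => //.
  have [P [P' [PP' P'P _]]] := AC.
  have := mulmx1_min P'P; lia.
subst s; rewrite det_mx00 mul1r; apply: stable_ratio_similar sB.
exists (col_mx 1%:M 0), (row_mx 1%:M 0); split.
- rewrite mul_col_row !mx01 [RHS]scalar_mx_block.
  by congr block_mx; apply/matrixP => -[].
- by rewrite mul_row_col !mx01.
by rewrite mul_col_mx mul_col_row !mx01 [C]flatmx0.
Qed.
End Matrices.

(** * Pairing off an infinite set *)
Lemma infinite_sequence (T : choiceType) (B : set T) : infinite_set B ->
  exists t : nat -> T, injective t /\ forall n, B (t n).
Proof.
move=> /infiniteP/card_leP[f].
exists (fun n => set_val (f (to_setT n))).
split=> [m n /val_inj h|n]; last exact: set_valP.
have : to_setT m = to_setT n by apply: (@inj _ _ setT f); rewrite ?inE.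
by move=> /(congr1 set_val).
Qed.

(** A maximal family of disjoint sequences leaves out a finite set only, which
    is prepended to one of the sequences. *)
Lemma infinite_sequences (T : choiceType) (B : set T) : infinite_set B ->
  exists S : set (nat -> T),
    [/\ forall s, S s -> injective s /\ forall n, B (s n),
        forall s s' m n, S s -> S s' -> s m = s' n -> s = s'
      & forall b, B b -> exists s n, S s /\ s n = b].
Proof.
move=> Binf.
pose P (S : set (nat -> T)) :=
  (forall s, S s -> injective s /\ forall n, B (s n)) /\
  (forall s s' m n, S s -> S s' -> s m = s' n -> s = s').
have [S [[SB Sdisj] Smax]] :
    exists S, P S /\ forall S', (S `<` S')%classic -> ~ P S'.
  apply: Zorn_bigcup => C CP Ctot; split=> [s [X CX Xs]|].
    exact: (CP X CX).1.
  move=> s s' m n [X CX Xs] [X' CX' Xs'].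
  have [XX'|X'X] := Ctot _ _ CX CX'.
    by apply: (CP X' CX').2 => //; apply: XX'.
  by apply: (CP X CX).2 => //; apply: X'X.
pose R : set T := [set b | B b /\ forall s n, S s -> s n <> b]%classic.
have Rfin : finite_set R.
  apply: contrapT => /infinite_sequence[t [tinj tR]].
  have tS : ~ S t by move=> St; exact: (tR 0%N).2 St erefl.
  apply: (Smax (S `|` [set t])%classic).
    split; first by move=> s; left.
    by move=> /(_ t) h; apply: tS; apply: h; right.
  split=> [s [/SB //|->]|s s' m n [Ss|->] [Ss'|->] //].
  - by split=> // n; exact: (tR n).1.
  - exact: Sdisj.
  - by move=> h; case: ((tR n).2 _ _ Ss h).
  - by move=> h; case: ((tR m).2 _ _ Ss' (esym h)).
have [l0 RE0] : exists l0 : seq T, R = [set` l0]%classic by exact/finite_seqP.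
pose l := undup l0.
have RE b : R b <-> b \in l by rewrite mem_undup RE0.
have [s0 Ss0] : exists s, S s.
  apply: contrapT => nS; apply: Binf; rewrite (_ : B = R) //.
  apply/seteqP; split=> b; last by case.
  by move=> Bb; split=> // s n Ss; case: nS; exists s.
have [s0inj s0B] := SB _ Ss0.
pose s1 n := if (n < size l)%N then nth (s0 0%N) l n else s0 (n - size l)%N.
have s1l n : (n < size l)%N -> R (s1 n).
  by move=> nl; rewrite /s1 nl; apply/RE/mem_nth.
have s1s n : (size l <= n)%N -> s1 n = s0 (n - size l)%N.
  by rewrite /s1 ltnNge => ->.
exists ([set s | S s /\ s <> s0] `|` [set s1])%classic; split.
- move=> s [[/SB //]|->]; split=> [m n|n]; last first.
    by have [/s1l[]|/s1s ->] := ltnP n (size l).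
  have [ml|lm] := ltnP m (size l); have [nl|ln] := ltnP n (size l).
  + rewrite /s1 ml nl => /eqP; rewrite nth_uniq ?undup_uniq // => /eqP; exact.
  + by rewrite (s1s _ ln) => h; case: ((s1l _ ml).2 _ _ Ss0 (esym h)).
  + by rewrite (s1s _ lm) => h; case: ((s1l _ nl).2 _ _ Ss0 h).
  + by rewrite !s1s // => /s0inj; lia.
- have s1new s m n : S s -> s <> s0 -> s m <> s1 n.
    move=> Ss ss0; have [nl h|ln] := ltnP n (size l).
      exact: (s1l _ nl).2 Ss h.
    by rewrite s1s // => /(Sdisj _ _ _ _ Ss Ss0).
  move=> s s' m n [[Ss ss0]|->] [[Ss' ss0']|->] // h.
  + exact: Sdisj h.
  + by case: (s1new _ _ _ Ss ss0 h).
  + by case: (s1new _ _ _ Ss' ss0' (esym h)).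
move=> b Bb.
have [[s [n [Ss sn]]]|nS] := pselect (exists s n, S s /\ s n = b); last first.
  have : b \in l by apply/RE; split=> // s n Ss sn; apply: nS; exists s, n.
  move=> bl; exists s1, (index b l); split; first by right.
  by rewrite /s1 index_mem bl nth_index.
have [ss0|ss0] := pselect (s = s0); last by exists s, n; split=> //; left.
exists s1, (n + size l)%N; split; first by right.
by rewrite s1s ?leq_addl // addnK -ss0.
Qed.

(** In each sequence of the partition, the terms 2n and 2n + 1 are exchanged by
    tau; o tells which of the two a point is. *)
Lemma infinite_pairing (T : choiceType) (B : set T) : infinite_set B ->
  exists (tau : T -> T) (o : T -> bool), forall b, B b ->
    [/\ B (tau b), tau (tau b) = b & o (tau b) = ~~ o b].
Proof.
move=> /infinite_sequences[S [SB Sdisj Scov]].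
have : forall b, exists p : (nat -> T) * nat, B b -> S p.1 /\ p.1 p.2 = b.
  move=> b; have [Bb|nB] := pselect (B b); last by exists (fun=> b, 0%N).
  by have [s [n sn]] := Scov b Bb; exists (s, n).
move=> /choice[ix ixP].
have ixE s n : S s -> ix (s n) = (s, n).
  move=> Ss; have [sinj sB] := SB _ Ss.
  have [Sx xE] := ixP _ (sB n).
  have e1 := Sdisj _ _ _ _ Sx Ss xE.
  by case: (ix _) e1 xE => s' m /= -> /sinj ->.
pose flip n := if odd n then n.-1 else n.+1.
have flipK n : flip (flip n) = n.
  by case: n => // n; rewrite /flip /=; case: (boolP (odd n)) => /= h;
    rewrite ?negbK ?h // (negPf h).
have oddflip n : odd (flip n) = ~~ odd n.
  by case: n => // n; rewrite /flip /=; case: (boolP (odd n)) => /= h;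
    rewrite ?negbK ?h // (negPf h).
exists (fun b => (ix b).1 (flip (ix b).2)), (fun b => odd (ix b).2) => b Bb.
have [Sx xE] := ixP _ Bb.
by rewrite !ixE //=; split=> //; [apply: (SB _ Sx).2 | rewrite flipK].
Qed.

(** * Bases of V made of a finite family and a set *)
Section Vectors.
Variables (F : fieldType) (V : lmodType F).

Definition cat_family m n (e : 'I_m -> V) (f : 'I_n -> V)
    (i : 'I_(m + n)) : V :=
  match fintype.split i with inl j => e j | inr k => f k end.

Lemma lcomb_split m n (e : 'I_(m + n) -> V) c :
  lcomb e c = lcomb (fun i => e (lshift n i)) (lsubmx c)
              + lcomb (fun i => e (rshift m i)) (rsubmx c).
Proof.
rewrite /lcomb big_split_ord /=.
by congr (_ + _); apply: eq_bigr => i _; rewrite mxE.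
Qed.

Lemma lcomb_cat m n (e : 'I_m -> V) (f : 'I_n -> V) a b :
  lcomb (cat_family e f) (row_mx a b) = lcomb e a + lcomb f b.
Proof.
rewrite lcomb_split row_mxKl row_mxKr; congr (_ + _); apply: eq_bigr => i _.
  by rewrite /cat_family (unsplitK (inl i)).
by rewrite /cat_family (unsplitK (inr i)).
Qed.

Lemma lcomb0 n (e : 'I_n -> V) : lcomb e 0 = 0.
Proof. by rewrite -[0 in LHS](subrr 0) lcombB subrr. Qed.

Lemma lcomb_add n (e e' : 'I_n -> V) c :
  lcomb (fun i => e i + e' i) c = lcomb e c + lcomb e' c.
Proof. by rewrite -big_split; apply: eq_bigr => i _; rewrite scalerDr. Qed.

Definition free_over n (e : 'I_n -> V) (B : set V) := forall s (c : V -> F) a,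
  uniq s -> (forall b, b \in s -> B b) ->
  \sum_(b <- s) c b *: b = lcomb e a -> forall b, b \in s -> c b = 0.

Definition expands n (e : 'I_n -> V) (B : set V) v s (c : V -> F) a :=
  [/\ uniq s, forall b, b \in s -> B b
    & v = lcomb e a + \sum_(b <- s) c b *: b].

Lemma maximal_free n (e : 'I_n -> V) (K : set V) :
  exists B : set V, [/\ (B `<=` K)%classic, free_over e B &
    forall v, K v -> exists s c a, expands e B v s c a].
Proof.
pose P (B : set V) := (B `<=` K)%classic /\ free_over e B.
have [B [[BK Bfree] Bmax]] :
    exists B, P B /\ forall B', (B `<` B')%classic -> ~ P B'.
  apply: Zorn_bigcup => C CP Ctot.
  split; first by move=> v [X CX] /((CP X CX).1).
  move=> s c a us sC.
  have : s = [::] \/ exists2 X, C X & forall b, b \in s -> X b.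
    elim: s us sC => [|b s IHs] /=; first by left.
    move=> /andP[_ /IHs{}IHs] sC; right.
    have [X CX Xb] := sC b (mem_head _ _).
    have [|s0|[Y CY Ys]] := IHs.
    - by move=> d ds; apply: sC; rewrite inE ds orbT.
    - by exists X => // d; rewrite s0 inE => /eqP ->.
    have [XY|YX] := Ctot _ _ CX CY.
      by exists Y => // d; rewrite inE => /orP[/eqP ->|/Ys //]; apply: XY.
    by exists X => // d; rewrite inE => /orP[/eqP -> //|/Ys]; apply: YX.
  by case=> [-> //|[X CX Xs]]; exact: (CP X CX).2.
exists B; split=> // v Kv; apply: contrapT => nv.
have nBv : ~ B v.
  move=> Bv; apply: nv; exists [:: v], (fun=> 1), 0; split=> //.
    by move=> b; rewrite inE => /eqP ->.
  by rewrite big_seq1 scale1r lcomb0 add0r.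
apply: (Bmax (B `|` [set v])%classic).
  split; first by move=> b; left.
  by move=> /(_ v) h; apply: nBv; apply: h; right.
split=> [b [/BK //|-> //]|s c a us sB sE].
have [vs|vs] := boolP (v \in s); last first.
  apply: (Bfree _ _ a) => // b bs; have [//|bv] := sB b bs.
  by move: vs; rewrite -bv bs.
have sE' := perm_big _ (perm_to_rem vs) : \sum_(b <- s) c b *: b = _.
rewrite sE big_cons /= in sE'.
have remB b : b \in rem v s -> B b.
  rewrite mem_rem_uniq // inE => /andP[bv /sB[//|bv']].
  by rewrite bv' eqxx in bv.
have urem : uniq (rem v s) by rewrite rem_uniq.
have cv : c v = 0.
  apply: contrapT => /eqP cv; apply: nv.
  exists (rem v s), (fun b => - ((c v)^-1 * c b)), ((c v)^-1 *: a); split=> //.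
  rewrite lcombZ sE' scalerDr scalerA mulVf // scale1r -addrA scaler_sumr.
  rewrite -big_split big1 ?addr0 //= => b _.
  by rewrite scalerA -scalerDl addrN scale0r.
rewrite cv scale0r add0r in sE'.
move=> b bs; have [->//|bv] := eqVneq b v.
by apply: (Bfree _ _ a urem remB (esym sE')); rewrite mem_rem_uniq // inE bv.
Qed.

(** Coefficients are extended by zero, in order to write two expansions over the
    same support. *)
Lemma big_extend (s t : seq V) (c : V -> F) (k : V -> V) :
  uniq s -> uniq t -> {subset s <= t} ->
  \sum_(b <- s) c b *: k b = \sum_(b <- t) (if b \in s then c b else 0) *: k b.
Proof.
move=> us ut st; rewrite (perm_big [seq b <- t | b \in s]) /=; last first.
  apply: uniq_perm; rewrite ?filter_uniq // => b.
  by rewrite mem_filter; case: (boolP (b \in s)) => [/st ->|].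
rewrite [RHS](bigID (mem s)) /= [X in _ + X]big1 ?addr0; last first.
  by move=> b /negPf ->; rewrite scale0r.
by rewrite big_filter; apply: eq_bigr => b ->.
Qed.

Lemma expands_merge n (e : 'I_n -> V) B v s c a v' s' c' a' :
  expands e B v s c a -> expands e B v' s' c' a' ->
  exists t d d', [/\ expands e B v t d a, expands e B v' t d' a',
    forall k : V -> V, \sum_(b <- s) c b *: k b = \sum_(b <- t) d b *: k b
    & forall k : V -> V,
        \sum_(b <- s') c' b *: k b = \sum_(b <- t) d' b *: k b].
Proof.
move=> [us sB vE] [us' sB' vE'].
exists (undup (s ++ s')), (fun b => if b \in s then c b else 0),
  (fun b => if b \in s' then c' b else 0).
have ut := undup_uniq (s ++ s').
have st : {subset s <= undup (s ++ s')}.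
  by move=> b bs; rewrite mem_undup mem_cat bs.
have st' : {subset s' <= undup (s ++ s')}.
  by move=> b bs; rewrite mem_undup mem_cat bs orbT.
have tB b : b \in undup (s ++ s') -> B b.
  by rewrite mem_undup mem_cat => /orP[/sB|/sB'].
by split=> [||k|k]; rewrite -?big_extend //; split;
  rewrite -?(big_extend c id) -?(big_extend c' id).
Qed.

Lemma expands_uniq n (e : 'I_n -> V) B v s c a s' c' a'
    (g : 'I_n -> V) (h : V -> V) :
  lin_indep e -> free_over e B ->
  expands e B v s c a -> expands e B v s' c' a' ->
  lcomb g a + \sum_(b <- s) c b *: h b
  = lcomb g a' + \sum_(b <- s') c' b *: h b.
Proof.
move=> e_ind Bfree vs vs'.
have [t [d [d' [[ut tB vE] [_ _ vE'] -> ->]]]] := expands_merge vs vs'.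
have dd' b : b \in t -> d b = d' b.
  move=> bt; apply/eqP; rewrite -subr_eq0; apply/eqP.
  apply: (Bfree t (fun b => d b - d' b) (a' - a)) => //.
  under eq_bigr do rewrite scalerBl.
  rewrite sumrB lcombB; apply/eqP; rewrite subr_eq addrAC -subr_eq opprK.
  by rewrite [X in X == _]addrC -vE -vE'.
have dE k : \sum_(b <- t) d b *: k b = \sum_(b <- t) d' b *: k b :> V.
  by apply: eq_big_seq => b /dd' ->.
rewrite dE; congr (_ + _); move: vE'; rewrite vE (dE id) => /addIr.
by move=> /(lin_indep_inj e_ind) ->.
Qed.

Definition basis_over n (e : 'I_n -> V) (B : set V) :=
  [/\ lin_indep e, free_over e B & forall v, exists s c a, expands e B v s c a].

Lemma endo_addv (f : endo V) v v' : f (v + v') = f v + f v'.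
Proof. exact: (raddfD (f : {linear V -> V})). Qed.

Lemma endo_scale (f : endo V) k v : f (k *: v) = k *: f v.
Proof. exact: (linearZ_LR (f : {linear V -> V})). Qed.

Lemma endo_sum (f : endo V) (s : seq V) (c : V -> F) :
  f (\sum_(b <- s) c b *: b) = \sum_(b <- s) c b *: f b.
Proof.
rewrite (raddf_sum (f : {linear V -> V})); apply: eq_bigr => b _.
exact: (linearZ_LR (f : {linear V -> V})).
Qed.

Lemma endo_eq_basis n (e : 'I_n -> V) B (f g : endo V) :
  basis_over e B -> (forall i, f (e i) = g (e i)) ->
  (forall b, B b -> f b = g b) -> f = g.
Proof.
move=> [_ _ Bgen] fge fgB; apply: endoP => v.
have [s [c [a [us sB ->]]]] := Bgen v.
rewrite !endo_addv !endo_lcomb !endo_sum; congr (_ + _).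
  by apply: eq_bigr => i _; rewrite /= fge.
by apply: eq_big_seq => b /sB/fgB ->.
Qed.

Lemma endo_of_basis n (e : 'I_n -> V) B (g : 'I_n -> V) (h : V -> V) :
  basis_over e B ->
  exists f : endo V, (forall i, f (e i) = g i) /\ (forall b, B b -> f b = h b).
Proof.
move=> [e_ind Bfree Bgen].
have : forall v, exists p : seq V * (V -> F) * 'rV[F]_n,
    expands e B v p.1.1 p.1.2 p.2.
  by move=> v; have [s [c [a vE]]] := Bgen v; exists (s, c, a).
move=> /choice[p pP].
pose f v := lcomb g (p v).2 + \sum_(b <- (p v).1.1) (p v).1.2 b *: h b.
have fE v s c a :
    expands e B v s c a -> f v = lcomb g a + \sum_(b <- s) c b *: h b.
  by move=> vE; apply: expands_uniq (pP v) vE.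
have flin : linear f.
  move=> k v v'.
  have [t [d [d' [[ut tB vE] [_ _ vE'] dE dE']]]] :=
    expands_merge (pP v) (pP v').
  rewrite (fE _ t (fun b => k * d b + d' b) (k *: (p v).2 + (p v').2)).
    rewrite /f dE dE' lcombD lcombZ scalerDr addrACA.
    congr (_ + _); rewrite scaler_sumr -big_split /=; apply: eq_bigr => b _.
    by rewrite scalerDl scalerA.
  split=> //; rewrite {1}vE {1}vE' lcombD lcombZ scalerDr addrACA.
  congr (_ + _); rewrite scaler_sumr -big_split /=; apply: eq_bigr => b _.
  by rewrite scalerDl scalerA.
pose fL : {linear V -> V} := HB.pack f (GRing.isLinear.Build _ _ _ _ f flin).
exists (fL : endo V); split=> [i|b Bb]; rewrite -[LHS]/(f _).
  rewrite (fE _ [::] (fun=> 0) (delta_mx 0 i)).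
    by rewrite lcomb_delta big_nil addr0.
  by split=> //; rewrite lcomb_delta big_nil addr0.
rewrite (fE _ [:: b] (fun=> 1) 0).
  by rewrite lcomb0 big_seq1 scale1r add0r.
split=> //; first by move=> d; rewrite inE => /eqP ->.
by rewrite lcomb0 big_seq1 scale1r add0r.
Qed.

(** * The basis adapted to u *)
Lemma free_size_leq n m (e : 'I_n -> V) (k : 'I_m -> V) :
  lin_indep k -> (forall i, spanned e (k i)) -> (m <= n)%N.
Proof.
move=> kind /spanned_mx[M kM].
suff /eqP <- : row_free M by exact: rank_leq_col.
rewrite -kermx_eq0; apply/eqP/row_matrixP => i; rewrite row0.
apply: kind; rewrite (lcomb_mul _ kM) -row_mul mulmx_ker row0.
by rewrite lcomb0.
Qed.

(** The family is given through preimages f, since these are needed as basis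
    vectors too. *)
Lemma image_basis (w : endo V) : finite_rank w ->
  exists r (f : 'I_r -> V),
    lin_indep (w \o f) /\ forall v, spanned (w \o f) (w v).
Proof.
move=> [n [e we]].
pose P r := `[< exists f : 'I_r -> V, lin_indep (w \o f) >].
have P0 : exists r, P r.
  exists 0%N; apply/asboolP; exists (fun=> 0) => c _; exact: thinmx0.
have Ple r : P r -> (r <= n)%N.
  by move=> /asboolP[f find]; apply: free_size_leq find (fun i => we (f i)).
have [r /asboolP[f find] rmax] := ex_maxnP P0 Ple.
exists r, f; split=> // v; apply: contrapT => nv.
suff : P (1 + r)%N by move=> /rmax; rewrite ltnn.
apply/asboolP; exists (cat_family (fun _ : 'I_1 => v) f) => c.
have -> : w \o cat_family (fun _ : 'I_1 => v) f
          = cat_family (fun _ : 'I_1 => w v) (w \o f).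
  by apply/funext => i; rewrite /cat_family /=; case: fintype.split.
rewrite -[c]hsubmxK lcomb_cat; set a := lsubmx c; set b := rsubmx c.
rewrite {1}/lcomb big_ord1 => ab0.
have a0 : a 0 0 = 0.
  apply: contrapT => /eqP a0; apply: nv; exists (- (a 0 0)^-1 *: b).
  rewrite lcombZ; apply: (scalerI a0); rewrite scalerA mulrN mulfV // scaleN1r.
  by apply/eqP; rewrite -addr_eq0; apply/eqP.
have b0 : b = 0 by apply: find; rewrite -[RHS]ab0 a0 scale0r add0r.
by rewrite b0 [a]mx11_scalar a0 raddf0 row_mx0.
Qed.

Lemma expands_finite n (e : 'I_n -> V) (B : set V) : finite_set B ->
  exists m (E : 'I_m -> V), forall v s c a, expands e B v s c a -> spanned E v.
Proof.
move=> /finite_seqP[l BE].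
exists (n + size l)%N, (cat_family e (fun i => tnth (in_tuple l) i)).
set E := cat_family _ _ => v s c a [_ sB ->].
have [x xE] : spanned E (\sum_(b <- s) c b *: b).
  elim: s sB => [|b s IHs] sB; first by exists 0; rewrite big_nil lcomb0.
  have [x xE] : spanned E (\sum_(b <- s) c b *: b).
    by apply: IHs => d ds; apply: sB; rewrite inE ds orbT.
  have /(nthP 0)[i il bE] : b \in l by have := sB b (mem_head _ _); rewrite BE.
  exists (c b *: row_mx 0 (delta_mx 0 (Ordinal il)) + x).
  rewrite big_cons lcombD lcombZ lcomb_cat lcomb0 add0r lcomb_delta xE.
  by rewrite (tnth_nth 0) /= bE.
by exists (row_mx a 0 + x); rewrite lcombD lcomb_cat lcomb0 addr0 xE.
Qed.

Definition acts n (e : 'I_n -> V) (x : endo V) (M : 'M[F]_n) :=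
  forall c, x (lcomb e c) = lcomb e (c *m M).

Lemma acts_of_basis n (e : 'I_n -> V) (x : endo V) M :
  (forall i, x (e i) = lcomb e (row i M)) -> acts e x M.
Proof. by move=> xM c; rewrite endo_lcomb (lcomb_mul _ xM). Qed.

Lemma endoN (f : endo V) v : f (- v) = - f v.
Proof. exact: (raddfN (f : {linear V -> V})). Qed.

Lemma endo_subv (f : endo V) v v' : f (v - v') = f v - f v'.
Proof. exact: (raddfB (f : {linear V -> V})). Qed.

(** On the plane spanned by p = b and q = tau b, where o b holds, the three
    factors are the matrices of [neg_unip3_block] for the identity matrix:
    x p = p + 4 q, y p = - p + 4 q, y q = 3 q - p, z q = q - p.
    Matrices act on rows, so their order is reversed in the composition. *)
Lemma neg_unip3_extend n (e : 'I_n -> V) (B : set V) (u : endo V) G :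
  basis_over e B -> infinite_set B -> (forall b, B b -> u b = b) ->
  acts e u G -> neg_unip3 G ->
  exists x y z : endo V,
    [/\ unipotent2 x, unipotent2 y, unipotent2 z & - u = x * y * z].
Proof.
move=> eB Binf uB uG [N1 [N2 [N3 [N1u N2u N3u GE]]]].
have [tau [o pairing]] := infinite_pairing Binf.
have tauB b : B b -> B (tau b) by move=> /pairing[].
have tauK b : B b -> tau (tau b) = b by move=> /pairing[].
have otau b : B b -> o (tau b) = ~~ o b by move=> /pairing[].
have build (M : 'M[F]_n) (h : V -> V) : exists x : endo V,
    acts e x M /\ forall b, B b -> x b = h b.
  have [x [xe xB]] := endo_of_basis (fun i => lcomb e (row i M)) h eB.
  by exists x; split=> //; exact: acts_of_basis.
have unip (x : endo V) M : acts e x M -> unipotent2 M ->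
    (forall b, B b -> (x - 1) ((x - 1) b) = 0) -> unipotent2 x.
  move=> xM; rewrite /unipotent2 !expr2 => Mu xB.
  apply: (endo_eq_basis eB) => [i|b Bb]; rewrite endoME endo0E; last exact: xB.
  have x1 c : (x - 1) (lcomb e c) = lcomb e (c *m (M - 1)).
    by rewrite endoBE endo1E xM mulmxBr lcombB mulmx1.
  by rewrite -[e i]lcomb_delta !x1 -mulmxA mulmxE Mu mulmx0 lcomb0.
have [x [xM xB]] := build N3 (fun b => if o b then b + 4 *: tau b else b).
have [y [yM yB]] := build N2 (fun b => if o b then - b + 4 *: tau b
                                       else 3 *: b - tau b).
have [z [zM zB]] := build N1 (fun b => if o b then b else b - tau b).
(* Identities in b and t are checked on coordinates, which are scalars. *)
have plane (b t : V) : exists L : F -> F -> V,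
    [/\ b = L 1 0, t = L 0 1,
        forall k l k' l', L k l + L k' l' = L (k + k') (l + l'),
        forall m k l, m *: L k l = L (m * k) (m * l)
      & 0 = L 0 0].
  exists (fun k l => k *: b + l *: t); split=> [|| k l k' l'|m k l|].
  - by rewrite scale1r scale0r addr0.
  - by rewrite scale1r scale0r add0r.
  - by rewrite !scalerDl addrACA.
  - by rewrite scalerDr !scalerA.
  - by rewrite !scale0r addr0.
pose endoE := (endo_subv, endo_addv, endo_scale, endoN).
exists x, y, z; split.
- apply: unip xM N3u _ => b Bb; have Btb := tauB b Bb.
  have [L [bE tE LD LZ L0]] := plane b (tau b).
  rewrite !endoBE !endo1E !(xB b Bb).
  case: ifPn => ob; rewrite !endoE ?(xB b Bb) ?(xB _ Btb) ?otau //
    ?ob ?(negPf ob) /=.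
    by rewrite ?tE bE -!scaleN1r L0 !(LD, LZ); congr L; ring.
  by rewrite ?tE bE -!scaleN1r L0 !(LD, LZ); congr L; ring.
- apply: unip yM N2u _ => b Bb; have Btb := tauB b Bb.
  have [L [bE tE LD LZ L0]] := plane b (tau b).
  rewrite !endoBE !endo1E !(yB b Bb).
  case: ifPn => ob; rewrite !endoE ?(yB b Bb) ?(yB _ Btb) ?otau //
    ?ob ?(negPf ob) /= tauK //.
    by rewrite ?tE bE -!scaleN1r L0 !(LD, LZ); congr L; ring.
  by rewrite ?tE bE -!scaleN1r L0 !(LD, LZ); congr L; ring.
- apply: unip zM N1u _ => b Bb; have Btb := tauB b Bb.
  have [L [bE tE LD LZ L0]] := plane b (tau b).
  rewrite !endoBE !endo1E !(zB b Bb).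
  case: ifPn => ob; rewrite !endoE ?(zB b Bb) ?(zB _ Btb) ?otau //
    ?ob ?(negPf ob) /= ?tauK //.
    by rewrite ?tE bE -!scaleN1r L0 !(LD, LZ); congr L; ring.
  by rewrite ?tE bE -!scaleN1r L0 !(LD, LZ); congr L; ring.
apply: (endo_eq_basis eB) => [i|b Bb]; rewrite endoNE !endoME.
  rewrite -[e i]lcomb_delta uG zM yM xM -!mulmxA (mulmxA N1) -GE.
  by rewrite mulmxN -[- _ in RHS]sub0r lcombB lcomb0 sub0r.
have Btb := tauB b Bb.
have [L [bE tE LD LZ L0]] := plane b (tau b).
rewrite (uB b Bb) (zB b Bb); case: ifPn => ob;
  rewrite ?endoE ?(yB b Bb) ?(yB _ Btb) ?otau // ?ob ?(negPf ob) /= ?tauK //;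
  rewrite !endoE !(xB b Bb) !(xB _ Btb) ?otau // ?ob ?(negPf ob) /= ?tauK //.
  by rewrite ?tE bE -!scaleN1r !(LD, LZ); congr L; ring.
by rewrite ?tE bE -!scaleN1r !(LD, LZ); congr L; ring.
Qed.

Definition kernel (w : endo V) : set V := [set v | w v = 0]%classic.

Lemma sub_preimage r (w : endo V) (f : 'I_r -> V) :
  (forall v, spanned (w \o f) (w v)) ->
  forall v, exists c, kernel w (v - lcomb f c).
Proof.
move=> wf v; have [c wv] := wf v; exists c.
by rewrite /kernel /= endo_subv wv endo_lcomb subrr.
Qed.

(** V is spanned by f and ker w, hence would have finite dimension. *)
Lemma kernel_free_infinite (infV : infinite_dim V) r (w : endo V)
    (f : 'I_r -> V) n (e : 'I_n -> V) (B : set V) :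
  (forall v, spanned (w \o f) (w v)) ->
  (forall v, kernel w v -> exists s c a, expands e B v s c a) ->
  infinite_set B.
Proof.
move=> wf Bgen /(expands_finite e)[m [E EP]]; apply: infV.
exists (r + m)%N, (cat_family f E) => v.
have [c /Bgen[s [c' [a /EP[d vE]]]]] := sub_preimage wf v.
by exists (row_mx c d); rewrite lcomb_cat -vE addrC subrK.
Qed.

Lemma kernel_free_family (infV : infinite_dim V) r (w : endo V) (f : 'I_r -> V)
    n (e : 'I_n -> V) m :
  (forall v, spanned (w \o f) (w v)) ->
  exists y : 'I_m -> V, (forall i, w (y i) = 0) /\
    forall c a, lcomb y c = lcomb e a -> c = 0.
Proof.
move=> wf.
have [B [BK Bfree Bgen]] := maximal_free e (kernel w).
have [t [tinj tB]] := infinite_sequence (kernel_free_infinite infV wf Bgen).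
exists (fun i => t i); split=> [i|c a ca]; first exact: BK (tB i).
pose s := [seq t (val i) | i <- enum 'I_m].
pose k b := if [pick i : 'I_m | t i == b] is Some i then c 0 i else 0.
have kt (i : 'I_m) : k (t i) = c 0 i.
  rewrite /k; case: pickP => [j /eqP/tinj/val_inj -> //|/(_ i)].
  by rewrite eqxx.
have us : uniq s.
  by rewrite map_inj_uniq ?enum_uniq // => i j /tinj/val_inj.
have sB b : b \in s -> B b by move=> /mapP[i _ ->].
have sE : \sum_(b <- s) k b *: b = lcomb e a.
  by rewrite -ca big_map big_enum /=; apply: eq_bigr => i _; rewrite kt.
apply/rowP => i; rewrite mxE -kt; apply: (Bfree _ _ _ us sB sE).
by rewrite map_f ?mem_enum.
Qed.

Lemma neg_unip3_adapted r (A : 'M[F]_r) : \det A = 1 \/ \det A = -1 ->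
  exists m1 m2, neg_unip3
    (block_mx 1%:M (block_mx 1%:M 0 0 0 : 'M_(r + m1, r + m2))
              0 (block_mx A 0 0 1%:M)).
Proof.
move=> detA; have uA : A \in unitmx.
  by rewrite unitmxE; case: detA => ->; rewrite ?unitrN unitr1.
have [r0|r0] := posnP r; last first.
  exact: neg_unip3_of_stable_ratio (stable_ratio_unit r0 uA) detA.
subst r; exists 0%N, 0%N, 1%:M, 1%:M, 1%:M.
by split; apply/matrixP => -[].
Qed.

(** The basis e is (f, y1 | kappa, y2), where f = f0 + ya and ya, y1, y2 are
    vectors of ker w that are independent modulo f0 and kappa; adding ya makes
    f independent of kappa. *)
Lemma adapted_basis (infV : infinite_dim V) (w : endo V) : finite_rank w ->
  exists r (A : 'M[F]_r), has_det (1 + w) (\det A) /\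
  forall m1 m2, exists (e : 'I_((r + m1) + (r + m2)) -> V) (B : set V),
    [/\ basis_over e B, infinite_set B, forall b, B b -> w b = 0
      & acts e (1 + w)
          (block_mx 1%:M (block_mx 1%:M 0 0 0) 0 (block_mx A 0 0 1%:M))].
Proof.
move=> wfin; have [r [f0 [kind wf]]] := image_basis wfin.
pose kap i : V := w (f0 i).
have [A AE] : exists A : 'M_r, forall i, (1 + w) (kap i) = lcomb kap (row i A).
  apply: spanned_mx => i; rewrite endoDE endo1E.
  have [c wc] := wf (kap i); exists (delta_mx 0 i + c).
  by rewrite lcombD lcomb_delta wc.
exists r, A; split.
  exists r, kap, A; split=> // v; rewrite addrC addKr; exact: wf.
move=> m1 m2.
have [y [wy yfree]] :=
  kernel_free_family infV (cat_family f0 kap) (r + m1 + m2) wf.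
pose ya i := y (lshift m2 (lshift m1 i)).
pose y1 i := y (lshift m2 (rshift r i)).
pose y2 i := y (rshift (r + m1) i).
pose f i := f0 i + ya i.
pose e := cat_family (cat_family f y1) (cat_family kap y2).
have wfE : w \o f = kap by apply/funext => i; rewrite /= /f endo_addv wy addr0.
have wf' v : spanned (w \o f) (w v) by rewrite wfE.
have eE c1 c2 c3 c4 : lcomb e (row_mx (row_mx c1 c2) (row_mx c3 c4))
    = lcomb f c1 + lcomb y1 c2 + (lcomb kap c3 + lcomb y2 c4).
  by rewrite !lcomb_cat.
have rowE (c : 'rV[F]_((r + m1) + (r + m2))) : exists c1 c2 c3 c4,
    c = row_mx (row_mx c1 c2) (row_mx c3 c4).
  exists (lsubmx (lsubmx c)), (rsubmx (lsubmx c)).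
  by exists (lsubmx (rsubmx c)), (rsubmx (rsubmx c)); rewrite !hsubmxK.
have eind : lin_indep e.
  move=> c; have [c1 [c2 [c3 [c4 ->]]]] := rowE c; rewrite eE => c0.
  have : lcomb y (row_mx (row_mx c1 c2) c4)
         = lcomb (cat_family f0 kap) (- row_mx c1 c3).
    rewrite lcomb_split row_mxKl row_mxKr lcomb_split row_mxKl row_mxKr.
    rewrite -[- _]sub0r lcombB lcomb0 sub0r lcomb_cat.
    apply/eqP; rewrite -addr_eq0 -c0 lcomb_add; apply/eqP.
    by rewrite [LHS](AC (3*2) ((4*1*2)*(5*3))).
  move=> /yfree; rewrite -[0 in X in X -> _]row_mx0 -[0 in X in X -> _]row_mx0.
  move=> /eq_row_mx[/eq_row_mx[c10 c20] c40].
  have c30 : c3 = 0.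
    by apply: kind; rewrite -[RHS]c0 c10 c20 c40 !lcomb0 !add0r addr0.
  by rewrite c10 c20 c30 c40 !row_mx0.
have [B [BK Bfree Bgen]] := maximal_free e (kernel w).
exists e, B; split.
- split=> // v.
  have [c /Bgen[s [c' [a [us sB vE]]]]] := sub_preimage wf' v.
  exists s, c', (row_mx (row_mx c 0) 0 + a); split=> //.
  rewrite lcombD -addrA -vE -[X in row_mx _ X]row_mx0 eE !lcomb0 !addr0.
  by rewrite addrC subrK.
- exact: (kernel_free_infinite infV wf' Bgen).
- by move=> b /BK.
move=> c; have [c1 [c2 [c3 [c4 ->]]]] := rowE c.
rewrite endoDE endo1E mul_row_block !mulmx1 mulmx0 addr0 !mul_row_block.
rewrite !(mulmx0, mulmx1, addr0, add0r) add_row_mx add0r !eE.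
rewrite !endo_addv !endo_lcomb lcombD.
have kapA : lcomb kap (c3 *m A) = lcomb kap c3 + lcomb (w \o kap) c3.
  by rewrite -(lcomb_mul c3 AE) -lcomb_add.
have wy0 n (g : 'I_n -> V) c' :
    (forall i, w (g i) = 0) -> lcomb (w \o g) c' = 0.
  by move=> wg; rewrite /lcomb big1 // => i _; rewrite /= wg scaler0.
rewrite wfE kapA (wy0 _ y1 _ (fun i => wy _)) (wy0 _ y2 _ (fun i => wy _)).
rewrite !addr0.
by rewrite [LHS](AC (2*2*2) (1*2*(5*(3*6)*4))).
Qed.
End Vectors.

Theorem proposition1p17 (F : fieldType) (V : lmodType F)
  (infV : infinite_dim V) (u : endo V) (u_SPf : SPf u)
  (det_u : has_det u 1 \/ has_det u (- 1)) :
  exists x y z : endo V,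
    [/\ unipotent2 x, unipotent2 y, unipotent2 z & - u = x * y * z].
Proof.
have [_ [w wfin uE]] := u_SPf; subst u.
have [r [A [detA basisA]]] := adapted_basis infV wfin.
have detA1 : \det A = 1 \/ \det A = -1.
  by case: det_u => /(has_det_uniq detA) ->; [left|right].
have [m1 [m2 G3]] := neg_unip3_adapted detA1.
have [e [B [eB Binf wB eG]]] := basisA m1 m2.
apply: neg_unip3_extend eB Binf _ eG G3 => b /wB wb.
by rewrite endoDE endo1E wb addr0.
Qed.
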